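(* Let $\mathcal{F}$ be a free filter on $\mathbb{N}$. The following statements are equivalent: (1) There exists an infinite-dimensional Banach space $X$ such that the stationary uniform $\mathcal{F}$-boundedness principle holds for $X$. (2) The stationary uniform $\mathcal{F}$-boundedness principle holds for every Fréchet space $X$. (3) $\mathcal{F}$ is both a rapid$^+$ filter and a weak P$^+$-filter.
   Context: $\mathbb{N}=\{0,1,2,\ldots\}$. A filter on $\mathbb{N}$ is a non-empty, upwards closed family $\mathcal{F}\subsetneq P(\mathbb{N})$ closed under finite intersections; it is free if it contains all cofinite subsets of $\mathbb{N}$. A set $A\subseteq\mathbb{N}$ is $\mathcal{F}$-stationary if $\mathbb{N}\setminus A\notin\mathcal{F}$ (equivalently, $A$ meets every element of $\mathcal{F}$). $(\forall_{\mathcal{F}}\, i\in\mathbb{N})\,\Phi(i)$ means $\{i\in\mathbb{N}:\Phi(i)\}\in\mathcal{F}$. $A\subseteq^* B$ means $A\setminus B$ is finite. For infinite $A\subseteq\mathbb{N}$, $\eta_A:\mathbb{N}\to A$ is the unique strictly increasing surjection. $\mathcal{F}$ is a weak P$^+$-filter if for every decreasing sequence $(A_k)_k$ of sets in $\mathcal{F}$ and every $\mathcal{F}$-stationary set $I$ there is an $\mathcal{F}$-stationary set $B\subseteq I$ with $B\subseteq^* A_k$ for every $k$. $\mathcal{F}$ is a rapid$^+$ filter if for every $\mathcal{F}$-stationary set $I$ and every strictly increasing $f:\mathbb{N}\to\mathbb{N}$ there is an $\mathcal{F}$-stationary set $B\subseteq I$ with $f(n)\le\eta_B(n)$ for all $n$.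 For topological vector spaces $X,Y$, $\mathcal{L}(X,Y)$ is the space of continuous linear maps. A sequence $(y_i)_i$ in $Y$ is $\mathcal{F}$-bounded if for every $0$-neighbourhood $V$ in $Y$ there is $t>0$ with $ty_i\in V$ $(\forall_{\mathcal{F}}\, i\in\mathbb{N})$. A sequence $(T_i)_i$ in $\mathcal{L}(X,Y)$ is pointwise $\mathcal{F}$-bounded if $(T_i(x))_i$ is $\mathcal{F}$-bounded for every $x\in X$; it is $\mathcal{F}$-stationary-equicontinuous if for every $\mathcal{F}$-stationary set $I$ and every $0$-neighbourhood $V$ in $Y$ there are a $0$-neighbourhood $U$ in $X$ and an $\mathcal{F}$-stationary set $J\subseteq I$ with $T_i[U]\subseteq V$ for all $i\in J$. The stationary uniform $\mathcal{F}$-boundedness principle holds for $X$ if for every locally convex space $Y$, every pointwise $\mathcal{F}$-bounded sequence in $\mathcal{L}(X,Y)$ is $\mathcal{F}$-stationary-equicontinuous. *)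

(* Defs.v *)
From HB Require Import structures.
From mathcomp Require Import all_boot all_order all_algebra.
From mathcomp Require Import complex.
From mathcomp Require Import all_classical all_reals topology normedtype.

Set Implicit Arguments.
Unset Strict Implicit.
Unset Printing Implicit Defensive.

Import Order.TTheory GRing.Theory Num.Theory.
Import numFieldNormedType.Exports.

Local Open Scope classical_set_scope.
Local Open Scope ring_scope.

(* Properness of filters is assumed separately, through [ProperFilter]. *)
Definition free_filter (F : set_system nat) : Prop :=
  @frechet_filter nat `<=` F.

Definition stationary (F : set_system nat) (A : set nat) : Prop :=
  ~ F (~` A).

Definition almost_subset (A B : set nat) : Prop := finite_set (A `\` B).

(* [e] is the function eta_A; such an [e] exists exactly when [A] is infinite,
   and it is then unique. *)
Definition enumerates (A : set nat) (e : nat -> nat) : Prop :=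
  {homo e : m n / (m < n)%N} /\ range e = A.

Definition weak_Pplus_filter (F : set_system nat) : Prop :=
  forall (A : nat -> set nat) (I : set nat),
    (forall k, F (A k)) -> (forall k, A k.+1 `<=` A k) -> stationary F I ->
    exists B, [/\ stationary F B, B `<=` I & forall k, almost_subset B (A k)].

Definition rapid_plus_filter (F : set_system nat) : Prop :=
  forall (I : set nat) (f : nat -> nat),
    stationary F I -> {homo f : m n / (m < n)%N} ->
    exists B, [/\ stationary F B, B `<=` I &
      exists2 eta, enumerates B eta & forall n, (f n <= eta n)%N].

(* In the definitions below [K] is meant to be R or R[i] with [R : realType];
   in either case [0 < t] in [K] says that [t] is a positive real number. *)

Definition F_bounded (K : numFieldType) (F : set_system nat)
    (Y : topologicalLmodType K) (y : nat -> Y) : Prop :=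
  forall V : set Y, nbhs 0 V ->
    exists2 t : K, 0 < t & \forall i \near F, V (t *: y i).

Definition pointwise_F_bounded (K : numFieldType) (F : set_system nat)
    (X Y : topologicalLmodType K) (T : nat -> {linear X -> Y}) : Prop :=
  forall x : X, F_bounded F (fun i => T i x).

Definition F_stationary_equicontinuous (K : numFieldType) (F : set_system nat)
    (X Y : topologicalLmodType K) (T : nat -> {linear X -> Y}) : Prop :=
  forall (I : set nat) (V : set Y), stationary F I -> nbhs 0 V ->
    exists (U : set X) (J : set nat),
      [/\ nbhs 0 U, stationary F J, J `<=` I &
          forall i, J i -> T i @` U `<=` V].

(* [tvsType] is the library's type of locally convex spaces. *)
Definition stationary_uniform_boundedness (K : numFieldType)
    (F : set_system nat) (X : topologicalLmodType K) : Prop :=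
  forall (Y : tvsType K) (T : nat -> {linear X -> Y}),
    (forall i, continuous (T i)) -> pointwise_F_bounded F T ->
    F_stationary_equicontinuous F T.

(* A locally convex space is Frechet if its topology comes from a complete
   translation-invariant metric. Completeness is not expressed through
   [completeType]: the uniform structure carried by a [tvsType] induces its
   topology but need not be translation invariant, so its Cauchy filters need
   not be those of the topological vector space. *)
Definition frechet_space (R : realType) (K : numFieldType) (X : tvsType K) :
    Prop :=
  exists d : X -> X -> R,
    [/\ [/\ forall x y, (d x y = 0) <-> (x = y),
            forall x y, d x y = d y x &
            forall x y z, d x z <= d x y + d y z],
        forall x y z, d (x + z) (y + z) = d x y,
        forall x, nbhs x =
          filter_from [set e : R | 0 < e] (fun e => [set y | d x y < e]) &
        forall u : nat -> X,
          (forall e, 0 < e -> exists N, forall m n,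
              (N <= m)%N -> (N <= n)%N -> d (u m) (u n) < e) ->
          exists l : X, u @ \oo --> l].

(* [Vector.axiom n X] is the type of linear isomorphisms of [X] with 'rV_n. *)
Definition infinite_dimensional (K : numFieldType) (X : lmodType K) : Prop :=
  forall n, Vector.axiom n X -> False.

(* Main.v *)
(* Sufficiency. Let (T_i) be pointwise F-bounded on a Frechet space X but
   unbounded near 0 along a stationary set I. The weak P+ and rapid+ properties
   give a stationary set {b_0 < b_1 < ...} inside I and points z_n -> 0 with
   p (T_(b_n) z_n) as large as desired, p being a continuous seminorm of Y. If
   w_n is a z_m maximising p (T_(b_n) z_m), then a gliding hump sum of c_n 4^-n w_n
   with c_n in {0, 1} is a point at which (p (T_(b_n) x))_n is unbounded.

   Necessity. If F is not rapid+, some fast growing f has no stationary subset of I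
   that grows faster; on the i in a long interval [f(N), f(N')) one puts functionals
   m u_i with u_i of norm at least 1/8 and sum u_i(x)^2 <= |x|^2 (Dvoretzky-Rogers),
   so that few of them are large at a given point. If F is not weak P+, witnessed
   by (A_k), one puts (k + 1) h_i on the i that leave the A's at the k-th step, where
   (h_i) has norms at least 1 and limsup |h_i x| <= |x| / (k + 1). In both cases the
   norms tend to infinity along F on I.

   The sequences (h_i) are a weak form of the Josefson-Nissenzweig theorem. Either
   some bounded sequence of functionals keeps its oscillation under passing to
   midpoint blocks, and then 2^m of its subsequences can be split simultaneously,
   which produces Rademacher averages that satisfy Bessel's inequality; or all
   its subsequences have nearly norm-convergent midpoint blocks, and then splitting
   them along a Cantor tree produces uncountably many separated points in the
   closure of a countable set. *)

Require Import Defs.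
From HB Require Import structures.
From mathcomp Require Import all_boot all_order all_algebra.
From mathcomp Require Import complex.
From mathcomp Require Import all_classical all_reals topology normedtype.
From mathcomp Require Import interval_inference perm sequences.
From mathcomp Require Import ring lra zify.

Set Implicit Arguments.
Unset Strict Implicit.
Unset Printing Implicit Defensive.

Import Order.TTheory GRing.Theory Num.Theory.
Import numFieldNormedType.Exports.

Local Open Scope classical_set_scope.
Local Open Scope ring_scope.

(** * Functionals dominated by a seminorm *)

Section Functionals.
Context {R : realType} {V : lmodType R}.
Implicit Types (p q : V -> R) (f g : V -> R).

Definition seminorm p : Prop :=
  (forall x y, p (x + y) <= p x + p y) /\ (forall a x, p (a *: x) = `|a| * p x).

Definition linear_functional f : Prop :=
  forall a x y, f (a *: x + y) = a * f x + f y.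

Definition dual_ball p f : Prop :=
  linear_functional f /\ forall x, `|f x| <= p x.

Definition bounded_functional p f : Prop :=
  linear_functional f /\ exists C, forall x, `|f x| <= C * p x.

Lemma dual_ball_bounded p f : dual_ball p f -> bounded_functional p f.
Proof. by move=> [fl fp]; split=> //; exists 1 => x; rewrite mul1r. Qed.

Lemma seminorm0 p : seminorm p -> p 0 = 0.
Proof. by move=> [_ pZ]; rewrite -(scale0r (0 : V)) pZ normr0 mul0r. Qed.

Lemma seminormN p x : seminorm p -> p (- x) = p x.
Proof. by move=> [_ pZ]; rewrite -scaleN1r pZ normrN1 mul1r. Qed.

Lemma seminorm_ge0 p x : seminorm p -> 0 <= p x.
Proof.
move=> ps; have := ps.1 x (- x).
by rewrite subrr seminorm0// seminormN//; lra.
Qed.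

Lemma seminormB p x y : seminorm p -> p (x - y) <= p x + p y.
Proof. by move=> ps; have := ps.1 x (- y); rewrite seminormN. Qed.

Section LinearFunctional.
Variables (f : V -> R) (fl : linear_functional f).

Lemma linear_functional0 : f 0 = 0.
Proof. by have := fl 1 0 0; rewrite scaler0 addr0 mul1r; lra. Qed.

Lemma linear_functionalD x y : f (x + y) = f x + f y.
Proof. by have := fl 1 x y; rewrite scale1r mul1r. Qed.

Lemma linear_functionalZ a x : f (a *: x) = a * f x.
Proof. by have := fl a x 0; rewrite linear_functional0 !addr0. Qed.

Lemma linear_functionalN x : f (- x) = - f x.
Proof. by rewrite -scaleN1r linear_functionalZ mulN1r. Qed.

End LinearFunctional.

(** Homogeneity is asked for nonnegative scalars only, which leaves room to lower [q] in one
    direction at a time until it becomes linear. *)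
Definition sublinear q : Prop :=
  (forall x y, q (x + y) <= q x + q y) /\
  (forall a x, 0 <= a -> q (a *: x) = a * q x).

Lemma sublinear0 q : sublinear q -> q 0 = 0.
Proof. by move=> [_ qZ]; rewrite -(scale0r (0 : V)) qZ// mul0r. Qed.

Lemma sublinear_geN q x : sublinear q -> - q (- x) <= q x.
Proof.
by move=> qs; have := qs.1 x (- x); rewrite subrr sublinear0//; lra.
Qed.

(* Lowering [q] as much as possible in the direction [- y]. *)
Lemma sublinear_lower q y : sublinear q ->
  exists q', [/\ sublinear q', forall x, q' x <= q x & q' (- y) <= - q y].
Proof.
move=> qs; have q0 := sublinear0 qs; have [qD qZ] := qs.
(* The lowered functional is the infimum of [S x]: the parameter [t = 0] shows that it is below [q],
   and [t = 1] at the point [- y] gives the value [- q y]. *)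
pose S x := [set q (x + t *: y) - t * q y | t in [set t : R | 0 <= t]].
have Slb x : lbound (S x) (- q (- x)).
  move=> _ [t /= t0 <-]; rewrite -qZ//.
  have := qD (x + t *: y) (- x); rewrite addrAC subrr add0r; lra.
have Shl x : has_lbound (S x) by exists (- q (- x)); exact: Slb.
have S0 x : S x !=set0 by exists (q (x + 0 *: y) - 0 * q y); exists 0 => /=.
have Shi x : has_inf (S x) by split.
exists (fun x => inf (S x)); split; last first.
- apply: ge_inf => //; exists 1 => //=.
  by rewrite scale1r addNr q0 mul1r sub0r.
- move=> x; apply: ge_inf => //; exists 0 => //=.
  by rewrite scale0r addr0 mul0r subr0.
split=> [x z|a x].
- apply/ler_addgt0Pr => e e0; have e20 : 0 < e / 2 by lra.
  have [_ [s /= s0 <-] hs] := inf_adherent e20 (Shi x).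
  have [_ [t /= t0 <-] ht] := inf_adherent e20 (Shi z).
  have : inf (S (x + z)) <= q (x + z + (s + t) *: y) - (s + t) * q y.
    by apply: ge_inf => //; exists (s + t) => //=; lra.
  have := qD (x + s *: y) (z + t *: y).
  rewrite addrACA -scalerDl; lra.
rewrite le_eqVlt => /orP[/eqP <-|a0].
  rewrite scale0r mul0r; apply/eqP; rewrite eq_le; apply/andP; split.
    by apply: ge_inf => //; exists 0 => //=; rewrite scale0r addr0 q0; lra.
  by apply: lb_le_inf => // _ [t /= t0 <-]; rewrite add0r qZ//; lra.
have an0 : a != 0 by rewrite gt_eqF.
apply/eqP; rewrite eq_le; apply/andP; split.
- rewrite -ler_pdivrMl//; apply: lb_le_inf => // _ [t /= t0 <-].
  rewrite ler_pdivrMl//; apply: ge_inf => //; exists (a * t).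
    by rewrite /= mulr_ge0// ltW.
  by rewrite -scalerA -scalerDr qZ ?ltW//; ring.
- apply: lb_le_inf => // _ [t /= t0 <-].
  have -> : q (a *: x + t *: y) - t * q y =
      a * (q (x + (a^-1 * t) *: y) - (a^-1 * t) * q y).
    by rewrite mulrBr -(qZ a (x + _)) ?ltW// scalerDr scalerA !mulrA divff// !mul1r.
  rewrite ler_pM2l//; apply: ge_inf => //; exists (a^-1 * t) => //=.
  by rewrite mulr_ge0// invr_ge0 ltW.
Qed.

(** Zorn's lemma for the reversed pointwise order. The infimum of a chain is again sublinear, and it
    is finite because every sublinear functional below [q] is at least [- q (- x)] at [x]. *)
Lemma minimal_sublinear q : sublinear q ->
  exists f, [/\ sublinear f, forall x, f x <= q x &
    forall g, sublinear g -> (forall x, g x <= f x) -> g = f].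
Proof.
move=> qs.
pose T := {f : V -> R | sublinear f /\ forall x, f x <= q x}.
pose r (s t : T) := `[< forall x, sval t x <= sval s x >].
have ext (s t : T) : sval s = sval t -> s = t.
  move: s t => [s ps] [t pt] /= st; subst t.
  by congr exist; exact: Prop_irrelevance.
have [||||[f [fs fq]] fmin] := @Zorn T r.
- by move=> t; apply/asboolP.
- move=> t1 t2 t3 /asboolP h1 /asboolP h2; apply/asboolP => x.
  exact: le_trans (h2 x) (h1 x).
- move=> s t /asboolP h1 /asboolP h2; apply: ext; apply/funext => x.
  by apply/eqP; rewrite eq_le h1 h2.
- move=> A Atot.
  have [[a0 Aa0]|A0] := pselect (A !=set0); last first.
    by exists (exist _ q (conj qs (fun x => lexx _))) => s As; case: A0; exists s.
  pose S x := [set sval t x | t in A].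
  have Slb x : lbound (S x) (- q (- x)).
    move=> _ [[t [ts tq]] At <-] /=.
    by have := sublinear_geN x ts; have := tq (- x); lra.
  have Shl x : has_lbound (S x) by exists (- q (- x)); exact: Slb.
  have S0 x : S x !=set0 by exists (sval a0 x); exists a0.
  have Shi x : has_inf (S x) by split.
  have Sle x t : A t -> inf (S x) <= sval t x.
    by move=> At; apply: ge_inf => //; exists t.
  have fs : sublinear (fun x => inf (S x)).
    split=> [x y|a x a0'].
      apply/ler_addgt0Pr => e e0; have e20 : 0 < e / 2 by lra.
      have [_ [s As <-] hs] := inf_adherent e20 (Shi x).
      have [_ [t At <-] ht] := inf_adherent e20 (Shi y).
      have [/asboolP st|/asboolP ts] := Atot _ _ As At.
      - have := (svalP t).1.1 x y; have := st x; have := Sle (x + y) _ At; lra.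
      - have := (svalP s).1.1 x y; have := ts y; have := Sle (x + y) _ As; lra.
    have [->|an0] := eqVneq a 0.
      rewrite scale0r mul0r; apply/eqP; rewrite eq_le; apply/andP; split.
        by rewrite (le_trans (Sle _ _ Aa0))// sublinear0//; exact: (svalP a0).1.
      apply: lb_le_inf => // _ [t At <-].
      by rewrite sublinear0//; exact: (svalP t).1.
    have ap : 0 < a by rewrite lt_def an0.
    apply/eqP; rewrite eq_le; apply/andP; split.
      rewrite -ler_pdivrMl//; apply: lb_le_inf => // _ [t At <-].
      by rewrite ler_pdivrMl// -(svalP t).1.2//; exact: Sle.
    apply: lb_le_inf => // _ [t At <-].
    by rewrite (svalP t).1.2// ler_pM2l//; exact: Sle.
  have fq x : inf (S x) <= q x.
    by rewrite (le_trans (Sle _ _ Aa0))//; exact: (svalP a0).2.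
  exists (exist _ (fun x => inf (S x)) (conj fs fq)) => s As.
  by apply/asboolP => x; exact: Sle.
exists f; split=> // g gs gf.
have gq x : g x <= q x by rewrite (le_trans (gf x)).
have := fmin (exist _ g (conj gs gq)); rewrite /r /= => h.
by have /(congr1 sval) /= := h (asboolT gf).
Qed.

(** By minimality, lowering [f] in the direction [- y] leaves it unchanged, so [f] is odd; an odd
    sublinear functional is linear. *)
Lemma minimal_sublinear_linear f : sublinear f ->
  (forall g, sublinear g -> (forall x, g x <= f x) -> g = f) ->
  linear_functional f.
Proof.
move=> fs fmin.
have fN y : f (- y) = - f y.
  have [g [gs gf gy]] := sublinear_lower y fs.
  have gE := fmin _ gs gf; rewrite gE in gy.
  apply/eqP; rewrite eq_le gy/=.
  by have := sublinear_geN (- y) fs; rewrite opprK.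
have fD x y : f (x + y) = f x + f y.
  apply/eqP; rewrite eq_le fs.1/=.
  have := fs.1 (x + y) (- y); rewrite addrK fN; lra.
move=> a x y; rewrite fD; congr (_ + _).
have [a0|a0] := leP 0 a; first exact: fs.2.
by rewrite -[a *: x]opprK -scaleNr fN fs.2 ?oppr_ge0 1?ltW// mulNr opprK.
Qed.

(** [p] is lowered in the direction [- x0] before a minimal sublinear functional is taken below it;
    this forces the value [p x0] at [x0]. *)
Theorem hahn_banach_norming p x0 : seminorm p ->
  exists2 f, dual_ball p f & f x0 = p x0.
Proof.
move=> ps.
have psub : sublinear p.
  by split=> [x y|a x a0]; [exact: ps.1|rewrite ps.2 ger0_norm].
have [q [qs qp qx0]] := sublinear_lower x0 psub.
have [f [fs fq fmin]] := minimal_sublinear qs.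
have fl := minimal_sublinear_linear fs fmin.
have fp x : f x <= p x by rewrite (le_trans (fq x)).
exists f.
  split=> // x; rewrite ler_norml fp andbT lerNl -linear_functionalN//.
  by rewrite (le_trans (fp _))// seminormN.
apply/eqP; rewrite eq_le fp/=.
have := le_trans (fq _) qx0; rewrite linear_functionalN//; lra.
Qed.

End Functionals.

(** * Midpoint blocks and Rademacher averages *)

Section MidpointHull.
Context {R : realType} {V : Type}.
Implicit Types (f g h : nat -> V -> R) (u v : V -> R) (p : V -> R).

(** Iterated midpoints take the place of convex combinations, so that the hull of a sequence is
    countable. *)
Inductive midhull f (n : nat) : (V -> R) -> Prop :=
| midhull_base i : (n <= i)%N -> midhull f n (f i)
| midhull_mid u v : midhull f n u -> midhull f n v ->
    midhull f n (fun x => (u x + v x) / 2).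

Definition mid_block g f : Prop :=
  exists k, forall n, (k <= n)%N -> midhull f n (g n).

Lemma midhull_le f m n u : (m <= n)%N -> midhull f n u -> midhull f m u.
Proof.
move=> mn; elim=> [i ni|v w _ hv _ hw]; last exact: midhull_mid.
by apply: midhull_base; exact: leq_trans ni.
Qed.

Lemma midhull_trans f g n u : (forall i, (n <= i)%N -> midhull f n (g i)) ->
  midhull g n u -> midhull f n u.
Proof.
by move=> h; elim=> [i /h//|v w _ hv _ hw]; exact: midhull_mid.
Qed.

Lemma mid_block_trans g f h : mid_block h g -> mid_block g f -> mid_block h f.
Proof.
move=> [k hk] [l gl]; exists (maxn k l) => n; rewrite geq_max => /andP[kn ln].
apply: midhull_trans (hk _ kn) => i ni; apply: midhull_le (ni) _.
by apply: gl; exact: leq_trans ni.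
Qed.

Lemma midhull_diff f n x (C : R) :
  (forall i j, (n <= i)%N -> (n <= j)%N -> f i x - f j x <= C) ->
  forall u v, midhull f n u -> midhull f n v -> u x - v x <= C.
Proof.
move=> fC u v; elim=> [i ni|u1 u2 _ h1 _ h2 hv]; last first.
  by have := h1 hv; have := h2 hv; lra.
by elim=> [j nj|v1 v2 _ h1 _ h2]; [exact: fC|lra].
Qed.

Lemma midhull_ge f n x (C : R) : (forall i, (n <= i)%N -> C <= f i x) ->
  forall u, midhull f n u -> C <= u x.
Proof. by move=> fC u; elim=> [i ni|u1 u2 _ h1 _ h2]; [exact: fC|lra]. Qed.

Lemma midhull_le_bound f n x (C : R) : (forall i, (n <= i)%N -> f i x <= C) ->
  forall u, midhull f n u -> u x <= C.
Proof. by move=> fC u; elim=> [i ni|u1 u2 _ h1 _ h2]; [exact: fC|lra]. Qed.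

(** Binary trees encode iterated midpoints; a node of any other shape gets the default value
    [f 0]. *)
Fixpoint mid_eval f (t : GenTree.tree nat) : V -> R :=
  match t with
  | GenTree.Leaf i => f i
  | GenTree.Node _ [:: s; t] => fun x => (mid_eval f s x + mid_eval f t x) / 2
  | _ => f 0
  end.

Lemma midhull_countable f :
  exists e : nat -> V -> R, forall u, midhull f 0 u -> exists k, e k = u.
Proof.
exists (fun k => if @unpickle (GenTree.tree nat) k is Some t
                 then mid_eval f t else f 0) => u hu.
suff [t <-] : exists t, mid_eval f t = u by exists (pickle t); rewrite pickleK.
elim: hu => [i _|v w _ [s <-] _ [t <-]]; first by exists (GenTree.Leaf i).
by exists (GenTree.Node 0 [:: s; t]).
Qed.

(** The oscillation is pointwise: [N] depends on [x]. The room [e] makes the infimum of all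
    admissible [c] admissible too. *)
Definition osc_le p f (c : R) : Prop :=
  forall x, p x <= 1 -> forall e : R, 0 < e ->
  exists N, forall i j, (N <= i)%N -> (N <= j)%N -> f i x - f j x <= c + e.

Lemma osc_le_block p f g c : mid_block g f -> osc_le p f c -> osc_le p g c.
Proof.
move=> [k gk] fc x px e e0; have [N hN] := fc x px e e0.
exists (maxn k N) => i j; rewrite !geq_max => /andP[ki Ni] /andP[kj Nj].
by apply: (midhull_diff hN); [apply: midhull_le (gk _ ki)|
  apply: midhull_le (gk _ kj)].
Qed.

Lemma mid_block_strict g f : mid_block g f ->
  exists g', (forall n, midhull f n (g' n)) /\ mid_block g' g.
Proof.
move=> [k gk]; exists (fun n => g (n + k)%N); split.
  move=> n; apply: (@midhull_le _ _ (n + k)%N); first exact: leq_addr.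
  by apply: gk; exact: leq_addl.
by exists 0 => n _; apply: midhull_base; exact: leq_addr.
Qed.

(** A diagonal argument. Each block comes within [1 / (k + 1)] of the least oscillation available to
    blocks of its predecessor. The diagonal sequence is a block of all of them, so no block of the
    diagonal oscillates less than it does. *)
Lemma osc_stable p f x0 c0 : p x0 <= 1 -> osc_le p f c0 ->
  exists g c, [/\ forall n, midhull f n (g n), osc_le p g c &
    forall h c', mid_block h g -> osc_le p h c' -> c <= c'].
Proof.
move=> px0 fc0.
pose A f := [set c | exists2 g, mid_block g f & osc_le p g c].
have Alb g : has_lbound (A g).
  exists 0 => c [h _ hc]; apply/ler_addgt0Pr => e e0.
  have [N /(_ N N (leqnn _) (leqnn _))] := hc x0 px0 e e0.
  by rewrite subrr.
have refl g : mid_block g g by exists 0 => n _; exact: midhull_base.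
have step (kf : nat * (nat -> V -> R)) : exists g, osc_le p kf.2 c0 ->
    (forall n, midhull kf.2 n (g n)) /\ osc_le p g (inf (A kf.2) + kf.1.+1%:R^-1).
  case: kf => k g /=; have [gc0|] := pselect (osc_le p g c0); last by exists g.
  have Ai : has_inf (A g) by split=> //; exists c0, g.
  have k0 : 0 < k.+1%:R^-1 :> R by rewrite invr_gt0.
  have [c [h hg hc] cl] := inf_adherent k0 Ai.
  have [h' [h'g h'h]] := mid_block_strict hg.
  exists h' => _; split=> // x px e e0.
  have [N hN] := osc_le_block h'h hc px e0.
  exists N => i j Ni Nj; apply: le_trans (hN i j Ni Nj) _.
  by rewrite lerD2r ltW.
have [nxt nxtP] := choice step.
pose F := fix F k := if k is k'.+1 then nxt (k', F k') else f.
have Fc0 k : osc_le p (F k) c0.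
  elim: k => //= k IH; have [hm _] := nxtP (k, F k) IH.
  by apply: osc_le_block IH; exists 0 => n _; exact: hm.
have FS k : (forall n, midhull (F k) n (F k.+1 n)) /\
    osc_le p (F k.+1) (inf (A (F k)) + k.+1%:R^-1).
  exact: (nxtP (k, F k) (Fc0 k)).
have Fmid k j n : midhull (F k) n (F (k + j)%N n).
  elim: j n => [|j IH] n; first by rewrite addn0; exact: midhull_base.
  rewrite addnS; apply: midhull_trans ((FS (k + j)%N).1 n) => i ni.
  exact: midhull_le ni (IH i).
pose g n := F n n.
have gF k : mid_block g (F k).
  by exists k => n kn; have := Fmid k (n - k)%N n; rewrite subnKC.
pose D := [set c | osc_le p g c].
have Dlb : has_lbound D.
  have [m hm] := Alb g; exists m => c gc; apply: hm; exists g => //.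
have gc0 : osc_le p g c0 := osc_le_block (gF 0) (Fc0 0).
exists g, (inf D); split.
- by move=> n; have := Fmid 0 n n.
- move=> x px e e0; have e20 : 0 < e / 2 by lra.
  have [|c gc cl] := @inf_adherent _ D _ e20; first by split=> //; exists c0.
  have [N hN] := gc x px _ e20.
  by exists N => i j Ni Nj; have := hN i j Ni Nj; lra.
- move=> h c' hg hc'; apply/ler_addgt0Pr => e e0.
  have [k ke] : exists k, k.+1%:R^-1 < e :> R.
    have [k hk] := ltr_add_invr e0; exists k; by rewrite add0r in hk.
  have : inf D <= inf (A (F k)) + k.+1%:R^-1.
    apply: ge_inf => //; exact: osc_le_block (gF k.+1) (FS k).2.
  have : inf (A (F k)) <= c'.
    by apply: ge_inf => //; exists h => //; exact: mid_block_trans hg (gF k).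
  move=> h1 h2; apply: (le_trans h2); exact: lerD h1 (ltW ke).
Qed.

End MidpointHull.

(** Cantor's diagonal argument: if [k] were injective, the word [d] would differ from every [w] at
    the place [k w], hence from itself. Two words with the same value are then compared at the first
    place where they differ. *)
Lemma cantor_collision (k : (nat -> bool) -> nat) :
  exists w w', k w = k w' /\ exists m, [/\ w m = true, w' m = false &
    forall n, (n < m)%N -> w n = w' n].
Proof.
suff [w [w' [kw ww']]] : exists w w', k w = k w' /\ w <> w'.
  have [m wm mmin] : exists2 m, w m != w' m & forall n, (n < m)%N -> w n = w' n.
    have ex : exists m, w m != w' m.
      apply: contrapT => h; apply: ww'; apply/funext => m.
      by apply/eqP/negPn/negP => wm; apply: h; exists m.
    case: (ex_minnP ex) => m wm mmin; exists m => // n nm.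
    by apply/eqP/negPn/negP => /mmin; rewrite leqNgt nm.
  case wmE : (w m); case wmE' : (w' m).
  - by rewrite wmE wmE' in wm.
  - by exists w, w'; split=> //; exists m; split.
  - by exists w', w; split=> //; exists m; split=> // n /mmin.
  - by rewrite wmE wmE' in wm.
apply: contrapT => inj.
pose d n := `[< forall w, k w = n -> w n = false >].
case hd : (d (k d)).
  by have /asboolP h : is_true (d (k d)) by []; rewrite h in hd.
have /asboolPn h : ~~ d (k d) by rewrite hd.
apply: h => w kw; have [<-//|ne] := pselect (d = w).
by case: inj; exists d, w; rewrite kw.
Qed.

(** * Limits of bounded real sequences along ultrafilters *)

Section UltrafilterLimit.
Context {R : realType}.

Lemma free_ultrafilter : exists2 U : set_system nat, UltraFilter U & \oo `<=` U.
Proof. by have [U [Uu hU]] := ultraFilterLemma (eventually_filter); exists U. Qed.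

(** Compactness of [[- B, B]] gives a cluster point, and an ultrafilter converges to each of its
    cluster points. *)
Lemma ultra_cvg (U : set_system nat) (UU : UltraFilter U) (a : nat -> R) (B : R) :
  (forall n, `|a n| <= B) -> exists l : R, a @ U --> l.
Proof.
move=> aB.
have UP : ProperFilter U := @ultra_proper _ U UU.
have aU : U (a @^-1` `[- B, B]%classic).
  by apply: filterE => n /=; rewrite in_itv/= -ler_norml; exact: aB.
have [l [_ cl]] := @segment_compact R (- B) B (a @ U) _ aU.
exists l => W lW.
have [//|UC] := in_ultra_setVsetC (a @^-1` W) UU.
have [y [/=]] : (a @` (~` (a @^-1` W))) `&` W !=set0.
  apply: cl => //; suff : U (a @^-1` (a @` (~` (a @^-1` W)))) by [].
  by apply: filterS UC => n nW; exists n.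
by move=> [n nW <-].
Qed.

End UltrafilterLimit.

(** * Means and Rademacher coefficients of functions on the discrete cube *)

Section Rademacher.
Context {R : realType}.
Implicit Types (u v : seq bool -> R).

Fixpoint cube_mean m u : R :=
  if m is m'.+1 then (cube_mean m' (fun s => u (true :: s)) +
                      cube_mean m' (fun s => u (false :: s))) / 2
  else u [::].

(* The coefficient of [u], restricted to words of length [m], on the
   coordinate function that counts [k] from the end of the word. *)
Fixpoint rademacher m k u : R :=
  if m is m'.+1 then
    if k == m' then (cube_mean m' (fun s => u (true :: s)) -
                     cube_mean m' (fun s => u (false :: s))) / 2
    else (rademacher m' k (fun s => u (true :: s)) +
          rademacher m' k (fun s => u (false :: s))) / 2
  else 0.

Lemma cube_mean_linear m a u v :
  cube_mean m (fun s => a * u s + v s) = a * cube_mean m u + cube_mean m v.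
Proof. by elim: m u v => //= m IH u v; rewrite !IH; field. Qed.

Lemma rademacher_linear m k a u v :
  rademacher m k (fun s => a * u s + v s) =
  a * rademacher m k u + rademacher m k v.
Proof.
elim: m u v => [|m IH] u v /=; first by rewrite mulr0 addr0.
by case: ifP => _; rewrite ?cube_mean_linear ?IH; field.
Qed.

Lemma cube_mean_ge m u r : (forall s, size s = m -> r <= u s) ->
  r <= cube_mean m u.
Proof.
elim: m u => [|m IH] u ur /=; first exact: ur.
have := IH (fun s => u (true :: s)); have := IH (fun s => u (false :: s)).
move=> /(_ (fun s sm => ur (_ :: s) (f_equal S sm))) h1.
move=> /(_ (fun s sm => ur (_ :: s) (f_equal S sm))) h2.
lra.
Qed.

Lemma cube_mean_le m u r : (forall s, size s = m -> u s <= r) ->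
  cube_mean m u <= r.
Proof.
elim: m u => [|m IH] u ur /=; first exact: ur.
have := IH (fun s => u (true :: s)); have := IH (fun s => u (false :: s)).
move=> /(_ (fun s sm => ur (_ :: s) (f_equal S sm))) h1.
move=> /(_ (fun s sm => ur (_ :: s) (f_equal S sm))) h2.
lra.
Qed.

(** The defects [M - u s] are nonnegative and add up to at most [2 ^ m * e], so none of them exceeds
    this sum. *)
Lemma cube_mean_near_max m u M e : (forall s, size s = m -> u s <= M) ->
  M - e <= cube_mean m u -> forall s, size s = m -> M - 2 ^+ m * e <= u s.
Proof.
elim: m u e => [|m IH] u e uM /= ue s; first by move/size0nil=> ->; lra.
have ht := cube_mean_le (fun s sm => uM (true :: s) (f_equal S sm)).
have hf := cube_mean_le (fun s sm => uM (false :: s) (f_equal S sm)).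
case: s => // b s [sm]; rewrite exprSr -mulrA.
by case: b; [apply: (IH (fun s => u (true :: s)))|
  apply: (IH (fun s => u (false :: s)))] => //;
  [by move=> w wm; apply: uM; rewrite /= wm|lra|
   by move=> w wm; apply: uM; rewrite /= wm|lra].
Qed.

Lemma cube_mean_near_min m u M e : (forall s, size s = m -> M <= u s) ->
  cube_mean m u <= M + e -> forall s, size s = m -> u s <= M + 2 ^+ m * e.
Proof.
elim: m u e => [|m IH] u e uM /= ue s; first by move/size0nil=> ->; lra.
have ht := cube_mean_ge (fun s sm => uM (true :: s) (f_equal S sm)).
have hf := cube_mean_ge (fun s sm => uM (false :: s) (f_equal S sm)).
case: s => // b s [sm]; rewrite exprSr -mulrA.
by case: b; [apply: (IH (fun s => u (true :: s)))|
  apply: (IH (fun s => u (false :: s)))] => //;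
  [by move=> w wm; apply: uM; rewrite /= wm|lra|
   by move=> w wm; apply: uM; rewrite /= wm|lra].
Qed.

(** Induction on [m]: the mean and the newest coefficient satisfy the parallelogram identity, and
    the older coefficients are midpoints, to which convexity of the square applies. *)
Lemma rademacher_bessel m u B : (forall s, `|u s| <= B) ->
  cube_mean m u ^+ 2 + \sum_(k < m) rademacher m k u ^+ 2 <= B ^+ 2.
Proof.
elim: m u => [|m IH] u uB /=.
  by rewrite big_ord0 addr0 -real_normK ?num_real// lerXn2r ?nnegrE//
    (le_trans _ (uB [::])).
rewrite big_ord_recr /= eqxx.
have := IH _ (fun s => uB (true :: s)); have := IH _ (fun s => uB (false :: s)).
set a := cube_mean m _; set b := cube_mean m _.
set ra := fun k => rademacher m k (fun s => u (true :: s)).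
set rb := fun k => rademacher m k (fun s => u (false :: s)).
move=> hb ha.
have : \sum_(k < m) (if (k : nat) == m then (b - a) / 2
    else (ra k + rb k) / 2) ^+ 2 <=
    (\sum_(k < m) ra k ^+ 2 + \sum_(k < m) rb k ^+ 2) / 2.
  rewrite -big_split/= mulr_suml; apply: ler_sum => k _.
  rewrite ltn_eqF//; have := sqr_ge0 (ra k - rb k); rewrite !expr2; lra.
rewrite /ra /rb; move: ha hb; rewrite !expr2; lra.
Qed.

Lemma midhull_cube_mean (V : Type) (f : nat -> V -> R) n m
    (u : seq bool -> V -> R) : (forall s, midhull f n (u s)) ->
  midhull f n (fun x => cube_mean m (fun s => u s x)).
Proof.
elim: m u => [|m IH] u uh /=; first exact: uh.
by apply: midhull_mid; apply: IH => s; exact: uh.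
Qed.

End Rademacher.

(** * The Josefson-Nissenzweig theorem, up to epsilon *)

Section JosefsonNissenzweig.
Context {R : realType} {V : lmodType R} (p : V -> R) (ps : seminorm p).
Implicit Types (f g h : nat -> V -> R) (u v : V -> R).

Lemma dual_ball_midhull f n u : (forall i, dual_ball p (f i)) ->
  midhull f n u -> dual_ball p u.
Proof.
move=> fb; elim=> // {}u v _ [ul up] _ [vl vp]; split=> [a x y|x].
  by rewrite ul vl; field.
have := up x; have := vp x; rewrite !ler_norml; lra.
Qed.

Lemma bounded_functional_comb a u v : bounded_functional p u ->
  bounded_functional p v -> bounded_functional p (fun x => a * (u x - v x)).
Proof.
move=> [ul [C uC]] [vl [D vD]]; split=> [b x y|]; first by rewrite ul vl; ring.
exists (`|a| * (C + D)) => x; rewrite normrM -mulrA ler_wpM2l//.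
by rewrite mulrDl (le_trans (ler_normB _ _))// lerD.
Qed.

Lemma osc_le_dual_ball f : (forall i, dual_ball p (f i)) -> osc_le p f 2.
Proof.
move=> fb x px e e0; exists 0 => i j _ _.
have := (fb i).2 x; have := (fb j).2 x; rewrite !ler_norml; lra.
Qed.

(* The average of the [2 ^ m] given subsequences is a midpoint block of [f],
   so it oscillates as much as [f] at some [x]; there all the averaged terms
   must be nearly extremal at the same time. *)
Lemma stable_split f c m (J : seq bool -> nat -> nat) :
  0 < c -> osc_le p f c ->
  (forall h c', mid_block h f -> osc_le p h c' -> c <= c') ->
  (forall s n, n <= J s n)%N ->
  exists (x : V) (r : R) (i j : nat -> nat),
    [/\ p x <= 1, forall n, (n <= i n)%N, forall n, (n <= j n)%N &
      forall s n, size s = m ->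
        r + c / 4 <= f (J s (i n)) x /\ f (J s (j n)) x <= r - c / 4].
Proof.
move=> c0 fc fmin Jn.
pose P : R := 2 ^+ m; have P0 : 0 < P by rewrite exprn_gt0.
(* With this [e], a mean that misses its extreme value by at most [4 * e] forces each of the [2 ^ m]
   averaged terms to miss it by at most [c / 8]. *)
pose e := c / (32 * P); have e0 : 0 < e by rewrite divr_gt0// mulr_gt0.
have Pe : P * e = c / 32 by rewrite /e; field; rewrite gt_eqF.
have P4 : 2 ^+ m * (4 * e) = c / 8.
  rewrite mulrCA; change (4 * (P * e) = c / 8); rewrite Pe; lra.
have P1 : 1 <= P by rewrite exprn_ege1// ler1n.
have ePe : e <= P * e by rewrite ler_peMl// ltW.
pose g n := fun x => cube_mean m (fun s => f (J s n) x).
have gh k n : (k <= n)%N -> midhull f k (g n).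
  move=> kn; apply: midhull_cube_mean => s; apply: midhull_base.
  exact: leq_trans kn (Jn _ _).
have gf : mid_block g f by exists 0 => n _; exact: gh.
(* If there were no such [x], the block [g] would oscillate by at most [c - e], against the
   minimality of [c]. *)
have [x px [[N0 hN0] pairs]] : exists2 x, p x <= 1 &
    (exists N0, forall i j, (N0 <= i)%N -> (N0 <= j)%N ->
       f i x - f j x <= c + e) /\
    forall N, exists ij : nat * nat, [/\ (N <= ij.1)%N, (N <= ij.2)%N &
      c - e < g ij.1 x - g ij.2 x].
  apply: contrapT => hx.
  suff : osc_le p g (c - e) by move/(fmin _ _ gf); lra.
  move=> x px e' e'0; apply: contrapT => hN; apply: hx; exists x => //; split.
    exact: fc.
  move=> N; apply: contrapT => hij; apply: hN; exists N => i j Ni Nj.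
  rewrite leNgt; apply/negP => gij; apply: hij; exists (i, j); split=> //=; lra.
have [ij ijP] := choice (fun n => pairs (maxn n N0)).
have hh := @midhull_diff _ _ f N0 x (c + e) hN0.
pose b := g (ij 0).1 x; pose a := g (ij 0).2 x.
have ijN n : [/\ (n <= (ij n).1)%N, (n <= (ij n).2)%N, (N0 <= (ij n).1)%N,
    (N0 <= (ij n).2)%N & c - e < g (ij n).1 x - g (ij n).2 x].
  by case: (ijP n); rewrite !geq_max => /andP[? ?] /andP[? ?].
have [_ _ Nb Na ab] := ijN 0; rewrite -/a -/b in ab.
exists x, ((a + b) / 2), (fun n => (ij n).1), (fun n => (ij n).2); split=> //.
- by move=> n; case: (ijN n).
- by move=> n; case: (ijN n).
move=> s n sm; have [_ _ Ni Nj gij] := ijN n.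
have hb : b - g (ij n).2 x <= c + e
  by exact: (hh _ _ (gh _ _ Nb) (gh _ _ Nj)).
have ha : g (ij n).1 x - a <= c + e
  by exact: (hh _ _ (gh _ _ Ni) (gh _ _ Na)).
have hba : b - a <= c + e
  by exact: (hh _ _ (gh _ _ Nb) (gh _ _ Na)).
split.
  have := @cube_mean_near_max _ m (fun s => f (J s (ij n).1) x) (a + c + e)
    (4 * e) _ _ s sm.
  rewrite P4 => h; apply: le_trans (h _ _); first lra.
    move=> w _; have : f (J w (ij n).1) x - a <= c + e.
      apply: (hh _ _ _ (gh _ _ Na)).
      by apply: midhull_base; exact: leq_trans Ni (Jn _ _).
    lra.
  rewrite -/(g (ij n).1 x); lra.
have := @cube_mean_near_min _ m (fun s => f (J s (ij n).2) x) (b - c - e)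
    (4 * e) _ _ s sm.
rewrite P4 => h; apply: le_trans (h _ _) _; last lra.
  move=> w _; have : b - f (J w (ij n).2) x <= c + e.
    apply: (hh _ _ (gh _ _ Nb)).
    by apply: midhull_base; exact: leq_trans Nj (Jn _ _).
  lra.
rewrite -/(g (ij n).2 x); lra.
Qed.

(* Rademacher averages of the [2 ^ m] subsequences obtained by [m] successive
   splittings satisfy Bessel's inequality, which survives in the limit. *)
Lemma stable_null_sequence f c : (forall i, dual_ball p (f i)) ->
  0 < c -> osc_le p f c ->
  (forall h c', mid_block h f -> osc_le p h c' -> c <= c') ->
  exists h, (forall k, bounded_functional p (h k) /\
                       exists2 x, p x <= 1 & c / 4 <= `|h k x|) /\
    forall x e, 0 < e -> exists N, forall n, (N <= n)%N -> `|h n x| <= e.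
Proof.
move=> fb c0 fc fmin.
pose T := ((V * R) * ((nat -> nat) * (nat -> nat)))%type.
have step (mJ : nat * (seq bool -> nat -> nat)) : exists t : T,
    (forall s n, n <= mJ.2 s n)%N ->
    [/\ p t.1.1 <= 1, forall n, (n <= t.2.1 n)%N, forall n, (n <= t.2.2 n)%N &
      forall s n, size s = mJ.1 ->
        t.1.2 + c / 4 <= f (mJ.2 s (t.2.1 n)) t.1.1 /\
        f (mJ.2 s (t.2.2 n)) t.1.1 <= t.1.2 - c / 4].
  case: mJ => m J /=; have [Jn|nJ] := pselect (forall s n, n <= J s n)%N.
    have [x [r [i [j h]]]] := stable_split m c0 fc fmin Jn.
    by exists ((x, r), (i, j)).
  by exists ((0, 0), (id, id)) => /nJ.
have [t tP] := choice step.
(* A new first letter tells which of the two index sequences of the latest splitting is followed. *)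
pose ext (q : T) (J : seq bool -> nat -> nat) : seq bool -> nat -> nat :=
  fun s n => if s is b :: s' then J s' (if b then q.2.1 n else q.2.2 n) else n.
pose J := fix J m := if m is m'.+1 then ext (t (m', J m')) (J m')
                     else fun _ n => n.
have Jn m : (forall s n, n <= J m s n)%N.
  elim: m => // m IH [|b s] n //=; have [_ hi hj _] := tP (m, J m) IH.
  by case: b; apply: leq_trans (IH _ _); [exact: hi|exact: hj].
pose x k := (t (k, J k)).1.1.
have px k : p (x k) <= 1 by have [] := tP (k, J k) (Jn k).
(* The splitting number [k] creates a coefficient of at least [c / 4] at [x k]; every later
   splitting replaces it by the mean of two such coefficients with other indices [n]. *)
have low m k n : (k < m)%N ->
    c / 4 <= rademacher m k (fun s => f (J m s n) (x k)).
  elim: m n => // m IH n; rewrite ltnS leq_eqVlt => /orP[/eqP ->|km] /=.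
    rewrite eqxx; have [_ _ _ h] := tP (m, J m) (Jn m).
    pose r := (t (m, J m)).1.2.
    have : r + c / 4 <= cube_mean m (fun s =>
        f (J m s ((t (m, J m)).2.1 n)) (x m)).
      by apply: cube_mean_ge => s sm; have [] := h s n sm.
    have : cube_mean m (fun s =>
        f (J m s ((t (m, J m)).2.2 n)) (x m)) <= r - c / 4.
      by apply: cube_mean_le => s sm; have [] := h s n sm.
    lra.
  rewrite ltn_eqF//.
  have := IH ((t (m, J m)).2.1 n) km; have := IH ((t (m, J m)).2.2 n) km; lra.
pose phi m k y := rademacher m k (fun s => f (J m s 0) y).
have phil m k : linear_functional (phi m k).
  move=> a y z; rewrite /phi -rademacher_linear; congr rademacher.
  by apply/funext => s; rewrite (fb _).1.
have bessel m K y : (K <= m)%N -> \sum_(k < K) phi m k y ^+ 2 <= p y ^+ 2.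
  move=> Km; have := @rademacher_bessel _ m (fun s => f (J m s 0) y) (p y).
  move=> /(_ (fun s => (fb _).2 y)); apply: le_trans.
  rewrite -[leLHS]add0r lerD ?sqr_ge0// -(subnKC Km) big_split_ord/=.
  by rewrite lerDl sumr_ge0// => k _; rewrite sqr_ge0.
have phip m k y : (k < m)%N -> `|phi m k y| <= p y.
  move=> km; have := bessel _ _ y km; rewrite big_ord_recr/= => h.
  rewrite -(@ler_pXn2r _ 2)// ?nnegrE// ?seminorm_ge0// real_normK ?num_real//.
  by apply: le_trans h; rewrite lerDr sumr_ge0// => i _; rewrite sqr_ge0.
have [U UU Ufree] := free_ultrafilter.
have UP : ProperFilter U := @ultra_proper _ U UU.
have Uge K : U [set m | (K <= m)%N] by apply: Ufree; exists K.
have lims k y : exists l : R, (fun m => phi (m + k.+1)%N k y) @ U --> l.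
  apply: (@ultra_cvg _ U UU _ (p y)) => m; apply: phip.
  by rewrite addnS ltnS leq_addl.
(* The values for [m <= k] are replaced by [0] to keep the bound [p y]; the limit along a free
   ultrafilter does not see this change. *)
have {}lims ky : exists l : R, (fun m => phi m ky.1 ky.2) @ U --> l.
  case: ky => k y /=.
  have [|l hl] := @ultra_cvg _ U UU
    (fun m => if (k < m)%N then phi m k y else 0) (p y).
    by move=> m; case: ifP => [/phip//|_]; rewrite normr0 seminorm_ge0.
  exists l; apply: cvg_trans hl; apply: near_eq_cvg.
  by apply: filterS (Uge k.+1) => m /= ->.
have [h0 hP0] := choice lims; pose h k y := h0 (k, y).
have hP k y : (fun m => phi m k y) @ U --> h k y := hP0 (k, y).
have hl k : linear_functional (h k).
  move=> a y z.
  apply: (cvg_unique (@norm_hausdorff _ R^o) (hP k (a *: y + z))).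
  have -> : (fun m => phi m k (a *: y + z)) =
      (fun m => a * phi m k y + phi m k z) by apply/funext => m; rewrite phil.
  by apply: cvgD => //; apply: cvgM => //; exact: cvg_cst.
have hbessel K y : \sum_(k < K) h k y ^+ 2 <= p y ^+ 2.
  have : (fun m => \sum_(k < K) phi m k y ^+ 2) @ U --> \sum_(k < K) h k y ^+ 2.
    apply: (@cvg_big _ _ (fun u v : R => u + v)) => [|k _]; first exact: add_continuous.
    by rewrite expr2; apply: cvgM.
  apply: (closed_cvg (fun l => l <= p y ^+ 2)); first exact: closed_le.
  by apply: filterS (Uge K) => m /= Km; exact: bessel.
exists h; split=> [k|y e e0].
  split; first split=> //.
    exists 1 => y; rewrite mul1r.
    have := hbessel k.+1 y; rewrite big_ord_recr/= => hk.
    rewrite -(@ler_pXn2r _ 2)// ?nnegrE// ?seminorm_ge0// real_normK ?num_real//.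
    by apply: le_trans hk; rewrite lerDr sumr_ge0// => i _; rewrite sqr_ge0.
  exists (x k) => //; apply: le_trans (ler_norm _).
  apply: (closed_cvg (fun l => c / 4 <= l) _ _ _ (hP k (x k))).
    exact: closed_ge.
  by apply: filterS (Uge k.+1) => m /= km; exact: low.
(* Bessel's inequality bounds the partial sums; the series converges, so its terms tend to [0]. *)
have sc : cvgn (series (fun k => h k y ^+ 2)).
  apply: nondecreasing_is_cvgn.
    apply/nondecreasing_seqP => n; rewrite !seriesEord/= big_ord_recr/=.
    by rewrite lerDl sqr_ge0.
  by exists (p y ^+ 2) => _ [n _ <-]; rewrite seriesEord/=; exact: hbessel.
have /cvgrPdist_le /(_ (e ^+ 2)) [|N _ hN] := cvg_series_cvg_0 sc.
  by rewrite exprn_gt0.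
exists N => n Nn; have := hN n Nn; rewrite /= sub0r normrN ger0_norm ?sqr_ge0//.
rewrite -[h n y ^+ 2]real_normK ?num_real// ler_pXn2r// ?nnegrE//.
exact: ltW.
Qed.

End JosefsonNissenzweig.

Lemma choice2 (X Y : Type) (P Q : X -> Y -> Prop) :
  (forall x, exists2 y, P x y & Q x y) ->
  exists2 f : X -> Y, forall x, P x (f x) & forall x, Q x (f x).
Proof.
move=> h; have {}h x : exists y, P x y /\ Q x y.
  by have [y ? ?] := h x; exists y.
by have [f fP] := choice h; exists f => x; have [] := fP x.
Qed.

(** * Separated sequences of functionals and the Cantor tree of splittings *)

Section EpsilonJosefsonNissenzweig.
Context {R : realType} {V : lmodType R} (p : V -> R) (ps : seminorm p).
Variables (f : nat -> V -> R) (e : R).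
Hypotheses (fb : forall i, dual_ball p (f i)) (e0 : 0 < e).
Hypothesis fsep :
  forall m n, m <> n -> exists2 x, p x <= 1 & 1 <= `|f m x - f n x|.

(** This is what the failure of the final theorem of this section provides for the given [e]; it is
    assumed until a contradiction appears. *)
Definition norming_tails : Prop := forall h : nat -> V -> R,
  (forall j, bounded_functional p (h j)) ->
  (forall j, exists2 x, p x <= 1 & 1 <= `|h j x|) ->
  exists2 x, p x <= 1 & forall N, exists2 n, (N <= n)%N & e < `|h n x|.

(** [norming_tails], applied to differences of two terms of the subsequence, gives a point with gaps
    larger than [e] arbitrarily far out. The midpoints of these gaps have a cluster value [l]; at
    gaps whose midpoint is within [e / 4] of [l], both ends stay [e / 4] away from [l]. *)
Lemma separated_split (J : nat -> nat) : norming_tails ->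
  (forall n, n <= J n)%N ->
  exists (x : V) (r : R) (i j : nat -> nat),
    [/\ p x <= 1, forall n, (n <= i n)%N, forall n, (n <= j n)%N &
      forall n, r + e / 4 <= f (J (i n)) x /\ f (J (j n)) x <= r - e / 4].
Proof.
move=> nt Jn.
have [||x px pairs] := nt (fun n x => 1 * (f (J n) x - f (J (J n).+1) x)).
- by move=> n; apply: bounded_functional_comb; exact: dual_ball_bounded.
- move=> n; have [|x px h] := fsep (m := J n) (n := J (J n).+1).
    by move=> h; have := Jn (J n).+1; rewrite -h ltnn.
  by exists x => //; rewrite mul1r.
have {}pairs N : exists ab : nat * nat, [/\ (N <= ab.1)%N, (N <= ab.2)%N &
    e < f (J ab.1) x - f (J ab.2) x].
  have [n Nn] := pairs N; rewrite mul1r ltr_normr => /orP[|] h.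
    by exists (n, (J n).+1); split=> //=; rewrite (leq_trans Nn)// leqW// Jn.
  exists ((J n).+1, n); split=> //=; first by rewrite (leq_trans Nn)// leqW// Jn.
  by move: h; rewrite opprB.
have [ab abP] := choice pairs.
have [U UU Ufree] := free_ultrafilter.
have UP : ProperFilter U := @ultra_proper _ U UU.
pose r n := (f (J (ab n).1) x + f (J (ab n).2) x) / 2.
have [|l hl] := @ultra_cvg _ U UU r (p x).
  move=> n; rewrite /r; have := (fb (J (ab n).1)).2 x.
  by have := (fb (J (ab n).2)).2 x; rewrite !ler_norml; lra.
have e40 : 0 < e / 4 by rewrite divr_gt0.
have near_l n : exists2 m, (n <= m)%N & `|l - r m| < e / 4.
  have /cvgrPdist_lt /(_ _ e40) Ul := hl.
  have Un : U [set m | (n <= m)%N] by apply: Ufree; exists n.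
  by have [m [? ?]] := filter_ex (filterI Ul Un); exists m.
have [m mn ml] := choice2 near_l.
exists x, l, (fun n => (ab (m n)).1), (fun n => (ab (m n)).2); split=> //.
- by move=> n; have [h _ _] := abP (m n); exact: leq_trans (mn n) h.
- by move=> n; have [_ h _] := abP (m n); exact: leq_trans (mn n) h.
- move=> n; have [_ _ h] := abP (m n); have := ml n.
  by rewrite /r ltr_norml; lra.
Qed.

(** The latest letter comes first, so that going down the tree prepends a letter. *)
Fixpoint path_word (w : nat -> bool) n : seq bool :=
  if n is n'.+1 then w n' :: path_word w n' else [::].

(* The splittings of all subsequences along a Cantor tree give uncountably many
   branches, each of which has a midpoint in [midhull f 0] that stays within
   [e / 8] of its tail; but [midhull f 0] is countable. *)
Lemma norming_tails_big_blocks : norming_tails ->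
  exists2 g, mid_block g f & forall h, mid_block h g ->
    ~ osc_le p h (e ^+ 2 / 16).
Proof.
move=> nt; apply: contrapT => nog.
have small g : mid_block g f ->
    exists2 h, mid_block h g & osc_le p h (e ^+ 2 / 16).
  move=> gf; apply: contrapT => noh; apply: nog; exists g => // h hg hc.
  by apply: noh; exists h.
pose T := ((V * R) * ((nat -> nat) * (nat -> nat)))%type.
have step (J : nat -> nat) : exists t : T, (forall n, n <= J n)%N ->
    [/\ p t.1.1 <= 1, forall n, (n <= t.2.1 n)%N, forall n, (n <= t.2.2 n)%N &
      forall n, t.1.2 + e / 4 <= f (J (t.2.1 n)) t.1.1 /\
                f (J (t.2.2 n)) t.1.1 <= t.1.2 - e / 4].
  have [Jn|nJ] := pselect (forall n, n <= J n)%N.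
    have [x [r [i [j h]]]] := separated_split nt Jn.
    by exists ((x, r), (i, j)).
  by exists ((0, 0), (id, id)) => /nJ.
have [t tP] := choice step.
pose S := fix S (s : seq bool) : nat -> nat := if s is b :: s' then
  fun n => S s' (if b then (t (S s')).2.1 n else (t (S s')).2.2 n) else id.
have Sn s : (forall n, n <= S s n)%N.
  elim: s => // b s IH n /=; have [_ hi hj _] := tP _ IH.
  by apply: leq_trans (IH _); case: b; [exact: hi|exact: hj].
have Spath w m k q : exists2 q', (q <= q')%N &
    S (path_word w (m + k)) q = S (path_word w m) q'.
  elim: k q => [|k IH] q; first by exists q => //; rewrite addn0.
  rewrite addnS /=.
  have [_ hi hj _] := tP _ (Sn (path_word w (m + k))).
  case: (w (m + k)).
    by have [q' qq' ->] := IH ((t (S (path_word w (m + k)))).2.1 q);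
      exists q' => //; exact: leq_trans (hi q) qq'.
  by have [q' qq' ->] := IH ((t (S (path_word w (m + k)))).2.2 q);
      exists q' => //; exact: leq_trans (hj q) qq'.
(* The diagonal subsequence along the branch [w]: from index [m + 1] on, its terms lie on the side
   that [w m] selects at the [m]-th node. *)
pose g w n := f (S (path_word w n) n).
have gf w : mid_block (g w) f.
  by exists 0 => n _; apply: midhull_base; exact: Sn.
pose x w m := (t (S (path_word w m))).1.1.
pose r w m := (t (S (path_word w m))).1.2.
have px w m : p (x w m) <= 1 by have [] := tP _ (Sn (path_word w m)).
have side w m n : (m < n)%N ->
    (w m = true -> r w m + e / 4 <= g w n (x w m)) /\
    (w m = false -> g w n (x w m) <= r w m - e / 4).
  move=> mn; have [q' _] := Spath w m.+1 (n - m.+1)%N n.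
  rewrite /g subnKC// => -> /=; have [_ _ _ h] := tP _ (Sn (path_word w m)).
  by split=> ->; have [] := h q'.
have limit w : exists2 q, midhull f 0 q & forall m,
    (w m = true -> r w m + e / 8 <= q (x w m)) /\
    (w m = false -> q (x w m) <= r w m - e / 8).
  have [h hg hosc] := small _ (gf w).
  have [k hk] := mid_block_trans hg (gf w).
  have hb n : (k <= n)%N -> dual_ball p (h n).
    by move=> /hk; exact: dual_ball_midhull.
  (* Otherwise [norming_tails], applied to differences divided by [e / 8], would give a point where
     [h] has gaps above [e ^+ 2 / 8] arbitrarily far out, whereas [hosc] leaves at most
     [e ^+ 2 / 16 + e ^+ 2 / 32]. *)
  have [N kN hN] : exists2 N, (k <= N)%N & forall n y, (N <= n)%N -> p y <= 1 ->
      `|h n y - h N y| <= e / 8.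
    apply: contrapT => noN.
    have far N : exists n, (maxn N k <= n)%N /\
        exists2 y, p y <= 1 & e / 8 < `|h n y - h (maxn N k) y|.
      apply: contrapT => non; apply: noN; exists (maxn N k).
        exact: leq_maxr.
      move=> n y Nn py; rewrite leNgt; apply/negP => hy; apply: non.
      by exists n; split=> //; exists y.
    have [n nP] := choice far.
    have e80 : 0 < e / 8 by rewrite divr_gt0.
    have [||y py hy] :=
        nt (fun N y => (e / 8)^-1 * (h (n N) y - h (maxn N k) y)).
    - move=> N; have [Nn _] := nP N.
      apply: bounded_functional_comb; apply: dual_ball_bounded; apply: hb.
        by apply: leq_trans Nn; exact: leq_maxr.
      exact: leq_maxr.
    - move=> N; have [_ [y py hy]] := nP N; exists y => //.
      by rewrite normrM ger0_norm ?invr_ge0 ?(ltW e80)// ler_pdivlMl// mulr1 ltW.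
    have e320 : 0 < e ^+ 2 / 32 by rewrite divr_gt0// exprn_gt0.
    have [M hM] := hosc y py _ e320.
    have [N MN] := hy M.
    rewrite normrM ger0_norm ?invr_ge0 ?(ltW e80)// ltr_pdivlMl//.
    have [Nn _] := nP N.
    have M1 : (M <= maxn N k)%N by rewrite (leq_trans MN)// leq_maxl.
    have M2 : (M <= n N)%N := leq_trans M1 Nn.
    have := hM _ _ M1 M2; have := hM _ _ M2 M1.
    have : 0 < e * e by rewrite mulr_gt0.
    by rewrite ltr_normr !expr2 => ? ? ? /orP[]; lra.
  exists (h N); first by apply: midhull_le (hk _ kN).
  move=> m; have [l hl] := hg.
  pose n := maxn N (maxn l m.+1).
  have Nn : (N <= n)%N by exact: leq_maxl.
  have ln : (l <= n)%N by rewrite /n maxnCA leq_maxl.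
  have mn : (m < n)%N by rewrite /n maxnA leq_maxr.
  have := hN n (x w m) Nn (px w m); rewrite ler_norml => /andP[h1 h2].
  split=> wm.
    have : r w m + e / 4 <= h n (x w m).
      apply: midhull_ge (hl _ ln) => i ni.
      by have [+ _] := side w m i (leq_trans mn ni); exact.
    lra.
  have : h n (x w m) <= r w m - e / 4.
    apply: midhull_le_bound (hl _ ln) => i ni.
    by have [_ +] := side w m i (leq_trans mn ni); exact.
  lra.
have [q qf qP] := choice2 limit.
have [en enP] := midhull_countable f.
have [k kP] := choice (fun w => enP _ (qf w)).
(* Two branches share their midpoint [q] and separate at the node [m]; there they have the same
   point and threshold, so the value of [q] would lie both above and below that threshold. *)
have [w [w' [kw [m [wm w'm ww']]]]] := cantor_collision k.
have pw : path_word w m = path_word w' m.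
  elim: m {wm w'm} ww' => //= m IH ww'; rewrite ww' ?ltnSn// IH// => n nm.
  by rewrite ww'// ltnW.
have qq : q w = q w' by rewrite -(kP w) -(kP w') kw.
have := (qP w m).1 wm; have := (qP w' m).2 w'm.
by rewrite qq /x /r pw; move: e0; lra.
Qed.

Theorem eps_josefson_nissenzweig :
  exists h : nat -> V -> R, (forall j, bounded_functional p (h j) /\
                       exists2 x, p x <= 1 & 1 <= `|h j x|) /\
    forall x, p x <= 1 -> exists N, forall n, (N <= n)%N -> `|h n x| <= e.
Proof.
apply: contrapT => noh.
have nt : norming_tails.
  move=> h hb h1; apply: contrapT => nox; apply: noh; exists h; split=> [j|x px].
    by split; [exact: hb|exact: h1].
  apply: contrapT => noN; apply: nox; exists x => // N.
  apply: contrapT => non; apply: noN; exists N => n Nn.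
  by rewrite leNgt; apply/negP => hn; apply: non; exists n.
have [g gf gosc] := norming_tails_big_blocks nt.
have [g1 [g1g bg1]] := mid_block_strict gf.
have g1b i : dual_ball p (g1 i) by exact: dual_ball_midhull (g1g i).
have p01 : p 0 <= 1 by rewrite seminorm0.
have [g2 [c [g2g1 g2c g2min]]] := osc_stable p01 (osc_le_dual_ball g1b).
have g2b i : dual_ball p (g2 i) by exact: dual_ball_midhull (g2g1 i).
have g2g : mid_block g2 g.
  by apply: mid_block_trans bg1; exists 0 => n _; exact: g2g1.
(* [g2] is a block of [g], and [gosc] forbids it to oscillate by [e ^+ 2 / 16] or less. *)
have c0 : 0 < c.
  have e160 : 0 < e ^+ 2 / 16 by rewrite divr_gt0// exprn_gt0.
  apply: (lt_trans e160); rewrite ltNge; apply/negP => ce.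
  apply: (gosc g2) => // x px d d0; have [N hN] := g2c x px d d0.
  by exists N => i j Ni Nj; have := hN i j Ni Nj; lra.
have [h [h1 h2]] := stable_null_sequence ps g2b c0 g2c g2min.
have c40 : 0 < c / 4 by lra.
apply: noh; exists (fun j x => (c / 4)^-1 * (h j x - (fun=> 0) x)); split=> [j|x _].
  have [hb [x px hx]] := h1 j; split.
    apply: bounded_functional_comb => //; split=> [a y z|]; first by ring.
    by exists 0 => y; rewrite normr0 mul0r.
  exists x => //; rewrite subr0 normrM ger0_norm ?invr_ge0 ?(ltW c40)//.
  by rewrite ler_pdivlMl// mulr1.
have [N hN] := h2 x (c / 4 * e) (mulr_gt0 c40 e0).
exists N => n Nn; rewrite subr0 normrM ger0_norm ?invr_ge0 ?(ltW c40)//.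
by rewrite ler_pdivrMl//; exact: hN.
Qed.

End EpsilonJosefsonNissenzweig.

(** * The Dvoretzky-Rogers lemma *)

Lemma scalar_mx1_inj (R : nzRingType) (a b : R) : a%:M = b%:M :> 'M_1 -> a = b.
Proof. by move/matrixP/(_ 0 0); rewrite !mxE eqxx. Qed.

Section SquaredNorm.
Context {R : realType} {n : nat}.
Implicit Types (v : 'cV[R]_n).

Definition sqnorm v : R := \sum_i v i 0 ^+ 2.

Lemma sqnormE v : (v^T *m v) = (sqnorm v)%:M.
Proof.
apply/matrixP => i j; rewrite !ord1 !mxE eqxx mulr1n; apply: eq_bigr => k _.
by rewrite !mxE expr2.
Qed.

Lemma sqnorm_ge0 v : 0 <= sqnorm v.
Proof. by apply: sumr_ge0 => i _; rewrite sqr_ge0. Qed.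

Lemma sqnorm0 : sqnorm 0 = 0.
Proof. by rewrite /sqnorm big1// => i _; rewrite mxE expr0n. Qed.

Lemma sqnorm_eq0 v : sqnorm v <= 0 -> v = 0.
Proof.
move=> v0; apply/matrixP => i j; rewrite ord1 mxE; apply/eqP.
rewrite -sqrf_eq0 eq_le sqr_ge0 andbT (le_trans _ v0)// /sqnorm (bigD1 i)//=.
by rewrite lerDl sumr_ge0// => k _; rewrite sqr_ge0.
Qed.

Lemma sqnormZ a v : sqnorm (a *: v) = a ^+ 2 * sqnorm v.
Proof.
by rewrite /sqnorm mulr_sumr; apply: eq_bigr => i _; rewrite mxE exprMn.
Qed.

End SquaredNorm.

(** * Projection and dilation along the complement of an orthonormal family *)

Section OrthonormalRows.
Context {R : realType} {k n : nat} (Y : 'M[R]_(k, n)).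
Hypothesis YY : Y *m Y^T = 1%:M.

(** The orthogonal projection onto the complement of the row space of [Y]. *)
Definition coproj : 'M[R]_n := 1%:M - Y^T *m Y.

Lemma coproj_tr : coproj^T = coproj.
Proof. by rewrite /coproj linearB/= trmx1 trmx_mul trmxK. Qed.

Lemma coproj_idem : coproj *m coproj = coproj.
Proof.
rewrite {1}/coproj mulmxBl mul1mx -mulmxA /coproj mulmxBr mulmx1.
by rewrite (mulmxA Y) YY mul1mx subrr mulmx0 subr0.
Qed.

Lemma mulmx_coproj : Y *m coproj = 0.
Proof. by rewrite /coproj mulmxBr mulmx1 mulmxA YY mul1mx subrr. Qed.

Lemma coproj_dot v : v^T *m (coproj *m v) = (sqnorm (coproj *m v))%:M.
Proof. by rewrite -sqnormE trmx_mul coproj_tr -mulmxA (mulmxA coproj) coproj_idem. Qed.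

Lemma sqnorm_coproj v : sqnorm v = sqnorm (Y *m v) + sqnorm (coproj *m v).
Proof.
apply: scalar_mx1_inj; rewrite raddfD/= -coproj_dot -!sqnormE.
rewrite trmx_mul -mulmxA -mulmxDr mulmxA /coproj mulmxBl mul1mx.
by rewrite -mulmxA addrC subrK.
Qed.

(** The matrix fixes the row space of [Y] and multiplies its complement by [4]; the factor [15] is
    [4 ^ 2 - 1]. *)
Lemma sqnorm_dilate v :
  sqnorm ((1%:M + 3 *: coproj) *m v) = sqnorm v + 15 * sqnorm (coproj *m v).
Proof.
pose w := coproj *m v.
have -> : (1%:M + 3 *: coproj) *m v = v + 3 *: w.
  by rewrite mulmxDl mul1mx scalemxAl.
have vw : v^T *m w = (sqnorm w)%:M by exact: coproj_dot.
have wv : w^T *m v = (sqnorm w)%:M.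
  by rewrite -[LHS]trmxK trmx_mul trmxK vw tr_scalar_mx.
have tr : (v + 3 *: w)^T = v^T + 3 *: w^T by rewrite linearD/= linearZ.
apply: scalar_mx1_inj; rewrite -sqnormE tr mulmxDl !mulmxDr.
rewrite -!scalemxAl -!scalemxAr vw wv !sqnormE -/w.
by apply/matrixP => i j; rewrite !mxE; case: eqP => _ /=; ring.
Qed.

(* Sylvester's determinant identity, read off the two block triangular
   factorisations of [block_mx 1 Y (3 Y^T) 4]. *)
Lemma det_dilate : \det (1%:M + 3 *: coproj) * 4 ^+ k = 4 ^+ n.
Proof.
pose M := block_mx (1%:M : 'M[R]_k) Y (3 *: Y^T) (4%:M : 'M_n).
have -> : 1%:M + 3 *: coproj = 4%:M - 3 *: (Y^T *m Y).
  rewrite /coproj scalerBr addrA; congr (_ - _).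
  by apply/matrixP => i j; rewrite !mxE; case: eqP => _ /=; ring.
have d1 : \det M = \det (4%:M - 3 *: (Y^T *m Y)).
  have : M *m block_mx 1%:M (- Y) 0 1%:M =
      block_mx 1%:M 0 (3 *: Y^T) (4%:M - 3 *: (Y^T *m Y)).
    rewrite mulmx_block !mulmx1 !mulmx0 !mulmxN mul1mx addNr !addr0.
    by congr block_mx; rewrite -scalemxAl addrC.
  move/(congr1 determinant).
  by rewrite det_mulmx det_ublock det_lblock !det1 !mulr1 mul1r.
have d2 : \det M = (4^-1) ^+ k * 4 ^+ n.
  have <- : \det (M *m block_mx 1%:M 0 (- (3 / 4) *: Y^T) 1%:M) = (4^-1) ^+ k * 4 ^+ n.
    rewrite mulmx_block !mulmx1 !mulmx0 !add0r.
    have -> : 1%:M + Y *m (- (3 / 4) *: Y^T) = (4^-1)%:M.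
      rewrite -scalemxAr YY; apply/matrixP => i j; rewrite !mxE.
      by case: eqP => _ /=; field.
    have -> : 3 *: Y^T + 4%:M *m (- (3 / 4) *: Y^T) = 0.
      by rewrite mul_scalar_mx scalerA -scalerDl mulrC; apply/matrixP => i j; rewrite !mxE; field.
    by rewrite det_ublock !det_scalar.
  by rewrite det_mulmx det_lblock !det1 !mulr1.
by rewrite -d1 d2 mulrAC -exprMn mulVf ?expr1n ?mul1r// pnatr_eq0.
Qed.

End OrthonormalRows.

Section DvoretzkyRogers.
Context {R : realType} {V : lmodType R} (p : V -> R) (ps : seminorm p).

(** Infinite dimension modulo the kernel of [p]: finitely many functionals of the dual ball always
    have a common zero on the unit sphere of [p]. *)
Definition dual_infinite : Prop := forall n (f : nat -> V -> R),
  (forall i, dual_ball p (f i)) ->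
  exists2 x, p x = 1 & forall i, (i < n)%N -> f i x = 0.

(** Alternately, [x n] is chosen in the common kernel of the functionals found so far, and [f n] by
    Hahn-Banach so as to norm [x n]. *)
Lemma dual_triangular : dual_infinite ->
  exists (f : nat -> V -> R) (x : nat -> V),
    [/\ forall i, dual_ball p (f i), forall n, p (x n) = 1,
      forall n, f n (x n) = 1 & forall i n, (i < n)%N -> f i (x n) = 0].
Proof.
move=> large.
have step (nP : nat * (nat -> V -> R)) : exists xg : V * (V -> R),
    (forall i, dual_ball p (nP.2 i)) ->
    [/\ p xg.1 = 1, dual_ball p xg.2, xg.2 xg.1 = 1 &
      forall i, (i < nP.1)%N -> nP.2 i xg.1 = 0].
  case: nP => n P /=; have [Pb|] := pselect (forall i, dual_ball p (P i)); last first.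
    by exists (0, fun=> 0).
  have [x px Px] := large n P Pb; have [g gb gx] := hahn_banach_norming x ps.
  by exists (x, g) => _; split=> //=; rewrite gx.
have [s sP] := choice step.
pose P := fix P n := if n is n'.+1 then
  fun i => if i == n' then (s (n', P n')).2 else P n' i else fun _ _ => 0.
have Pb n i : dual_ball p (P n i).
  elim: n i => [|n IH] i /=.
    by split=> [a x y|x]; [rewrite mulr0 addr0|rewrite normr0 seminorm_ge0].
  by case: eqP => // _; have [] := sP (n, P n) IH.
pose f n := P n.+1 n; pose x n := (s (n, P n)).1.
have fP n i : (i < n)%N -> P n i = f i.
  elim: n => // n IH; rewrite ltnS leq_eqVlt => /orP[/eqP ->//|lt_in] /=.
  by rewrite ltn_eqF// IH.
have fE n : f n = (s (n, P n)).2 by rewrite /f /= eqxx.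
exists f, x; split=> [i|n|n|i n lt_in].
- exact: Pb.
- by have [] := sP (n, P n) (Pb n).
- by rewrite fE; have [] := sP (n, P n) (Pb n).
- by rewrite -(fP n)//; have [_ _ _ h] := sP (n, P n) (Pb n); exact: h.
Qed.

(** The Leibniz expansion has one term of modulus at most [1] for each permutation. *)
Lemma leibniz_det_bound n (A : 'M[R]_n) : (forall i j, `|A i j| <= 1) ->
  `|\det A| <= #|{: {perm 'I_n}}|%:R.
Proof.
move=> A1; rewrite (le_trans (ler_norm_sum _ _ _))//.
rewrite -sum1_card natr_sum ler_sum// => s _.
rewrite normrM normrX normrN1 expr1n mul1r normr_prod.
by apply: prodr_ile1 => i _; rewrite normr_ge0 A1.
Qed.

(* [A] nearly maximises the determinant among the linear images
   [x |-> A (f_1 x, ..., f_n x)] that map the unit ball of [p] into the Euclidean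
   ball. If the part of the image orthogonal to the rows of [Y] were small, then
   dilating along it would increase the determinant too much. *)
Theorem dvoretzky_rogers d : dual_infinite ->
  exists u : nat -> V -> R,
    (forall i, (i < d)%N -> bounded_functional p (u i) /\
        exists2 x, p x <= 1 & 8^-1 <= `|u i x|) /\
    forall x, \sum_(i < d) u i x ^+ 2 <= p x ^+ 2.
Proof.
move=> large; case: d => [|d'].
  exists (fun _ _ => 0); split=> // x.
  by rewrite big_ord0 sqr_ge0.
(* Twice the required dimension: at each of the [d] steps the complement of the rows already found
   keeps at least half of it. *)
set d := d'.+1; pose n := (d + d)%N.
have [f [x [fb px fx1 fx0]]] := dual_triangular large.
pose Fv y : 'cV[R]_n := \col_i f i y.
have FvD a y z : Fv (a *: y + z) = a *: Fv y + Fv z.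
  by apply/matrixP => i j; rewrite !mxE (fb i).1.
pose adm (A : 'M[R]_n) := forall y, sqnorm (A *m Fv y) <= p y ^+ 2.
pose X : 'M[R]_n := \matrix_(i, j) f i (x j).
have detX : \det X = 1.
  rewrite det_trig; last by apply/is_trig_mxP => i j ij; rewrite mxE fx0.
  by rewrite big1// => i _; rewrite mxE.
pose D : set R := [set `|\det A| | A in adm].
(* As [\det X = 1], the determinant of [A] is that of [A *m X], whose columns are images of unit
   vectors and so have entries of modulus at most [1]. *)
have Dub : ubound D #|{: {perm 'I_n}}|%:R.
  move=> _ [A Aadm <-].
  have -> : \det A = \det (A *m X) by rewrite det_mulmx detX mulr1.
  apply: leibniz_det_bound => i j.
  have -> : (A *m X) i j = (A *m Fv (x j)) i 0.
    by rewrite !mxE; apply: eq_bigr => k _; rewrite !mxE.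
  rewrite -(@ler_pXn2r _ 2)// ?nnegrE// expr1n real_normK ?num_real//.
  have := Aadm (x j); rewrite px expr1n; apply: le_trans.
  rewrite /sqnorm [leRHS](bigD1 i)//= lerDl sumr_ge0// => k _.
  by rewrite sqr_ge0.
pose a : R := n.+1%:R^-1; have a0 : 0 < a by rewrite invr_gt0.
have aadm : adm a%:M.
  move=> y; rewrite mul_scalar_mx sqnormZ.
  have h : sqnorm (Fv y) <= n.+1%:R ^+ 2 * p y ^+ 2.
    apply: (@le_trans _ _ (\sum_(i < n) p y ^+ 2)).
      apply: ler_sum => i _; rewrite mxE -[leLHS]real_normK ?num_real//.
      by rewrite ler_pXn2r ?nnegrE ?normr_ge0 ?(seminorm_ge0 y ps)// (fb i).2.
    rewrite sumr_const card_ord -[leLHS]mulr_natl ler_wpM2r ?sqr_ge0//.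
    by rewrite -natrX ler_nat expnS expn1 (leq_trans (leqnSn n))// leq_pmulr.
  rewrite -ler_pdivlMl ?exprn_gt0// (le_trans h)// ler_wpM2r ?sqr_ge0//.
  by rewrite /a exprVn invrK.
have Dsup : has_sup D by split; [exists `|\det (a%:M : 'M[R]_n)|, a%:M|exists #|{: {perm 'I_n}}|%:R].
have sup0 : 0 < sup D.
  apply: (@lt_le_trans _ _ `|\det (a%:M : 'M_n)|).
    by rewrite det_scalar normrX exprn_gt0// normr_gt0 gt_eqF.
  by apply: ub_le_sup; [case: Dsup|exists a%:M].
have sup20 : 0 < sup D / 2 by rewrite divr_gt0.
have [_ [A Aadm <-] detA] := sup_adherent sup20 Dsup.
have {}detA : sup D < 2 * `|\det A| by move: detA; lra.
have detA0 : 0 < `|\det A| by move: detA sup0; lra.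
have far k (Y : 'M[R]_(k, n)) : Y *m Y^T = 1%:M -> (k + k <= n)%N ->
    exists y, p y ^+ 2 < 60 * sqnorm (coproj Y *m (A *m Fv y)).
  move=> YY kn; apply: contrapT => noy.
  (* If no [y] were far, the dilation would raise the bound on squared norms by at most
     [1 + 15 / 60 = 5 / 4]; since [(8 / 9) ^ 2 * (5 / 4) < 1], [A'] is admissible. But its
     determinant is at least [(16 / 9) ^ n] times that of [A] in modulus, and [n] is at least [2],
     so the factor exceeds [2]. *)
  pose A' := (8 / 9) *: ((1%:M + 3 *: coproj Y) *m A).
  have A'adm : adm A'.
    move=> y; rewrite /A' -scalemxAl sqnormZ -mulmxA sqnorm_dilate//.
    have : 60 * sqnorm (coproj Y *m (A *m Fv y)) <= p y ^+ 2.
      by rewrite leNgt; apply/negP => h; apply: noy; exists y.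
    have := Aadm y; have := sqr_ge0 (p y); lra.
  have : `|\det A'| <= sup D by apply: ub_le_sup; [case: Dsup|exists A'].
  move/le_lt_trans => /(_ _ detA).
  rewrite /A' detZ det_mulmx !normrM mulrA ltr_pM2r//.
  suff : 2 <= `|(8 / 9) ^+ n| * `|\det (1%:M + 3 *: coproj Y)| by lra.
  have -> : \det (1%:M + 3 *: coproj Y) = 4 ^+ (n - k).
    have k0 : 4 ^+ k != 0 :> R by rewrite expf_neq0// pnatr_eq0.
    apply: (mulIf k0); rewrite det_dilate// -exprD subnK//.
    exact: leq_trans (leq_addr _ _) kn.
  rewrite !normrX !ger0_norm//.
  apply: (@le_trans _ _ ((8 / 9) ^+ n * 2 ^+ n)); last first.
    rewrite ler_wpM2l ?exprn_ge0 ?divr_ge0//.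
    have -> : 4 = 2 ^+ 2 :> R by rewrite expr2; ring.
    by rewrite -exprM ler_eXn2l ?ltr1n//; lia.
  rewrite -exprMn; apply: (@le_trans _ _ ((8 / 9 * 2) ^+ 2)).
    by rewrite expr2; lra.
  by apply: ler_weXn2l; [lra|rewrite /n /d; lia].
have build k : (k <= d)%N -> exists2 Y : 'M[R]_(k, n), Y *m Y^T = 1%:M &
    forall i, exists2 y, p y <= 1 & 8^-1 <= `|(Y *m (A *m Fv y)) i 0|.
  elim: k => [|k IH] kd.
    by exists 0; [apply/matrixP => -[]|case].
  have [Y YY Yfar] := IH (ltnW kd).
  have kn : (k + k <= n)%N by rewrite leq_add// ltnW.
  have [y yfar] := far k Y YY kn.
  (* The normalised [w] becomes the new row. At [y] divided by [p y] its value is the norm of [w]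
     over [p y], which exceeds [1 / 8] because [60 < 64]. *)
  pose w := coproj Y *m (A *m Fv y).
  have py0 : 0 < p y.
    rewrite lt_def seminorm_ge0// andbT; apply/eqP => py0.
    have := Aadm y; rewrite py0 expr0n => /sqnorm_eq0 Ay.
    by move: yfar; rewrite Ay mulmx0 sqnorm0 mulr0 py0 expr0n ltxx.
  have w0 : 0 < sqnorm w.
    by have : 0 < p y ^+ 2 by [rewrite exprn_gt0]; move: yfar; rewrite -/w; lra.
  pose b := Num.sqrt (sqnorm w); have b0 : 0 < b by rewrite sqrtr_gt0.
  have bb : b ^+ 2 = sqnorm w by rewrite sqr_sqrtr// ltW.
  have Yw : Y *m w = 0 by rewrite /w mulmxA mulmx_coproj// mul0mx.
  have wAF : w^T *m (A *m Fv y) = (sqnorm w)%:M.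
    by rewrite /w trmx_mul coproj_tr -mulmxA coproj_dot.
  pose C : 'M[R]_(1 + k, n) := col_mx (b^-1 *: w^T) Y.
  have CC : C *m C^T = 1%:M.
    rewrite tr_col_mx mul_col_row YY linearZ/= trmxK -!scalemxAl -!scalemxAr.
    rewrite sqnormE Yw !scaler0 scalerA -invfM -expr2 bb scale_scalar_mx.
    rewrite mulVf ?gt_eqF//.
    have -> : w^T *m Y^T = 0 by rewrite -trmx_mul Yw trmx0.
    by rewrite scaler0 -scalar_mx_block.
  have Cfar (i : 'I_(1 + k)) :
      exists2 y, p y <= 1 & 8^-1 <= `|(C *m (A *m Fv y)) i 0|.
    rewrite /C; case: (split_ordP i) => j ->; last first.
      by have [z pz hz] := Yfar j; exists z => //; rewrite mul_col_mx col_mxEd.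
    rewrite ord1; exists ((p y)^-1 *: y).
      rewrite ps.2 ger0_norm; last by rewrite invr_ge0 ltW.
      by rewrite mulVf// gt_eqF.
    rewrite mul_col_mx col_mxEu -scalemxAl mxE.
    have -> : Fv ((p y)^-1 *: y) = (p y)^-1 *: Fv y.
      by apply/matrixP => l m; rewrite !mxE (linear_functionalZ (fb l).1).
    rewrite -!scalemxAr wAF !mxE mulr1n -bb.
    have -> : b^-1 * ((p y)^-1 * b ^+ 2) = b / p y.
      by field; rewrite !gt_eqF.
    rewrite ger0_norm; last by rewrite divr_ge0// ltW.
    rewrite ler_pdivlMr// -(@ler_pXn2r _ 2)// ?nnegrE; last exact: ltW.
      2: by rewrite mulr_ge0 ?invr_ge0 ?(ltW py0).
    rewrite exprMn bb; move: yfar (sqr_ge0 (p y)); rewrite -/w !expr2; lra.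
  by exists C.
have [Y YY Yfar] := build d (leqnn d).
exists (fun i y => (Y *m (A *m Fv y)) (inord i) 0); split=> [i id|y].
  split; last exact: Yfar.
  have lin z w c : (Y *m (A *m Fv (c *: z + w))) (inord i) 0 =
      c * (Y *m (A *m Fv z)) (inord i) 0 + (Y *m (A *m Fv w)) (inord i) 0.
    by rewrite FvD !mulmxDr -!scalemxAr !mxE.
  split=> [c z w|]; first exact: lin.
  exists 1 => z; rewrite mul1r -(@ler_pXn2r _ 2)// ?nnegrE ?normr_ge0 ?(seminorm_ge0 z ps)//.
  rewrite real_normK ?num_real//; apply: le_trans (Aadm z).
  rewrite (sqnorm_coproj YY) /sqnorm (bigD1 (inord i))//= -addrA lerDl.
  by rewrite addr_ge0// sumr_ge0// => j _; rewrite sqr_ge0.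
apply: le_trans (Aadm y); rewrite (sqnorm_coproj YY).
rewrite -[leLHS]addr0 lerD ?sqnorm_ge0// /sqnorm le_eqVlt; apply/orP; left.
by apply/eqP; apply: eq_bigr => i _; rewrite inord_val.
Qed.

End DvoretzkyRogers.

(** * Necessity, for real functionals *)

Section StationarySets.
Context (F : set_system nat) (FF : ProperFilter F) (Ffree : free_filter F).
Implicit Types (A B I : set nat).

Lemma not_stationary B : ~ stationary F B -> F (~` B).
Proof. by move/contrapT. Qed.

Lemma stationary_infinite B : stationary F B -> infinite_set B.
Proof.
by move=> sB fB; apply: sB; apply: Ffree; rewrite /frechet_filter/= setCK.
Qed.

Lemma stationaryI A B : stationary F B -> F A -> stationary F (B `&` A).
Proof.
move=> sB FA FBA; apply: sB; apply: filterS (filterI FA FBA) => i [Ai BAi] Bi.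
exact: BAi.
Qed.

Lemma stationary_ge B n : stationary F B -> exists2 i, B i & (n <= i)%N.
Proof.
move=> sB; apply: contrapT => noi; apply: (stationary_infinite sB).
apply: (sub_finite_set _ (finite_II n)) => i Bi /=.
by rewrite ltnNge; apply/negP => ni; apply: noi; exists i.
Qed.

End StationarySets.

Lemma enumerates_infinite (B : set nat) : infinite_set B ->
  exists eta, enumerates B eta.
Proof.
move=> Binf.
have next n : exists m, [/\ (n <= m)%N, B m & forall k, B k -> (n <= k)%N -> (m <= k)%N].
  have ex : exists m, (n <= m)%N && `[< B m >].
    apply: contrapT => nom; apply: Binf.
    apply: (sub_finite_set _ (finite_II n)) => i Bi /=.
    rewrite ltnNge; apply/negP => ni; apply: nom; exists i.
    by rewrite ni; exact/asboolP.
  case: (ex_minnP ex) => m /andP[nm /asboolP Bm] mmin; exists m; split=> //.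
  by move=> k Bk nk; apply: mmin; rewrite nk; exact/asboolP.
have [nx nxP] := choice next.
pose eta := fix eta n := if n is n'.+1 then nx (eta n').+1 else nx 0.
have etaS n : (eta n < eta n.+1)%N by have [] := nxP (eta n).+1.
have etalt : {homo eta : m n / (m < n)%N} by exact: homo_ltn ltn_trans etaS.
have etaB n : B (eta n) by case: n => [|n] /=; [have [] := nxP 0|have [] := nxP (eta n).+1].
have etage n : (n <= eta n)%N by elim: n => // n IH; exact: leq_ltn_trans IH (etaS n).
exists eta; split=> //; apply/seteqP; split=> [_ [n _ <-]//|b Bb].
have ex : exists n, (b <= eta n)%N by exists b.
case: (ex_minnP ex) => -[|n] bn nmin.
  exists 0%N => //; apply/eqP; rewrite eqn_leq bn andbT.
  by have [_ _ h] := nxP 0%N; exact: h.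
exists n.+1 => //; apply/eqP; rewrite eqn_leq bn andbT.
have [_ _ h] := nxP (eta n).+1; apply: h => //.
by rewrite ltnNge; apply/negP => /nmin; rewrite ltnn.
Qed.

Section NecessityForFunctionals.
Context (F : set_system nat) (FF : ProperFilter F) (Ffree : free_filter F).
Context {R : realType} {V : lmodType R} (p : V -> R) (ps : seminorm p).
Hypothesis large : dual_infinite p.

(** The scalar form of the principle, with equicontinuity along [J] written as a common norm
    bound. *)
Definition functional_uniform_boundedness : Prop :=
  forall T : nat -> V -> R, (forall i, bounded_functional p (T i)) ->
  (forall x, exists C, F [set i | `|T i x| <= C]) ->
  forall I, stationary F I -> exists J C,
    [/\ stationary F J, J `<=` I & forall i x, J i -> `|T i x| <= C * p x].

Hypothesis ub : functional_uniform_boundedness.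

Lemma unit_ball_pointwise_bounded (T : nat -> V -> R) :
  (forall i, linear_functional (T i)) ->
  (forall x, p x <= 1 -> F [set i | `|T i x| <= 1]) ->
  forall x, exists C, F [set i | `|T i x| <= C].
Proof.
move=> Tl T1 x; have px := seminorm_ge0 x ps.
have c0 : 0 < p x + 1 by lra.
have h : p ((p x + 1)^-1 *: x) <= 1.
  by rewrite ps.2 ger0_norm ?invr_ge0 ?(ltW c0)// ler_pdivrMl//; lra.
exists (p x + 1); apply: filterS (T1 _ h) => i /=.
rewrite (linear_functionalZ (Tl i)) normrM ger0_norm ?invr_ge0 ?(ltW c0)//.
by rewrite ler_pdivrMl// mulr1.
Qed.

Lemma zero_functional_bounded : bounded_functional p (fun=> 0).
Proof.
split=> [a x y|]; first by rewrite mulr0 addr0.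
by exists 0 => x; rewrite normr0 mul0r.
Qed.

Lemma bounded_functionalZ a (u : V -> R) : bounded_functional p u ->
  bounded_functional p (fun x => a * u x).
Proof.
move=> ub'; have := bounded_functional_comb a ub' zero_functional_bounded.
by congr bounded_functional; apply/funext => x; rewrite subr0.
Qed.

Lemma functional_uniform_boundedness_weak_Pplus : weak_Pplus_filter F.
Proof.
move=> A I FA Adec sI; apply: contrapT => noB.
have Ale k m : (k <= m)%N -> A m `<=` A k.
  move=> /subnK <-; elim: (m - k)%N => // n IH; rewrite addSn.
  exact: subset_trans (Adec _) IH.
have [f [x [fb px fx1 fx0]]] := dual_triangular ps large.
have fsep m n : m <> n -> exists2 y, p y <= 1 & 1 <= `|f m y - f n y|.
  wlog mn : m n / (m < n)%N.
    move=> h /eqP; rewrite neq_ltn => /orP[mn|nm].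
      by apply: h => //; apply/eqP; rewrite ltn_eqF.
    by have [|y py hy] := h n m nm; [apply/eqP; rewrite ltn_eqF|
      exists y => //; rewrite distrC].
  by move=> _; exists (x n); rewrite ?px// fx0// fx1 sub0r normrN1.
have exH k : exists h : nat -> V -> R, (forall j, bounded_functional p (h j) /\
    exists2 y, p y <= 1 & 1 <= `|h j y|) /\
    forall y, p y <= 1 -> exists N, forall n, (N <= n)%N -> `|h n y| <= k.+1%:R^-1.
  by apply: (eps_josefson_nissenzweig ps fb) => //; rewrite invr_gt0.
have [H HP] := choice exH.
(* [k] is the first step at which [i] leaves the sets [A]; the default [0] serves the [i] outside
   [I] and those that never leave. *)
have exk i : exists k, (I i /\ ~ A k i /\ forall l, (l < k)%N -> A l i) \/
    (k = 0%N /\ (~ I i \/ forall l, A l i)).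
  have [Ii|] := pselect (I i); last by exists 0%N; right; split=> //; left.
  have [Ai|] := pselect (forall l, A l i).
    by exists 0%N; right; split=> //; right.
  move=> nA; have ex : exists k, ~~ `[< A k i >].
    apply: contrapT => nok; apply: nA => l; apply: contrapT => nAl.
    by apply: nok; exists l; exact/asboolPn.
  case: (ex_minnP ex) => k /asboolPn nAk kmin; exists k; left; split=> //.
  split=> // l lk; apply: contrapT => /asboolPn /kmin.
  by rewrite leqNgt lk.
have [kk kkP] := choice exk.
pose act i := `[< I i /\ ~ A (kk i) i >].
pose T i y := if act i then (kk i).+1%:R * H (kk i) i y else 0.
have Tb i : bounded_functional p (T i).
  case ai : (act i); last first.
    suff -> : T i = fun=> 0 by exact: zero_functional_bounded.
    by apply/funext => y; rewrite /T ai.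
  have -> : T i = (fun y => (kk i).+1%:R * H (kk i) i y).
    by apply/funext => y; rewrite /T ai.
  by apply: bounded_functionalZ; have [h _] := HP (kk i); have [] := h i.
have [|J [C [sJ JI JC]]] := ub Tb _ sI.
  apply: unit_ball_pointwise_bounded => [i|y py]; first exact: (Tb i).1.
  (* If this set of bad indices were stationary, it would be the set excluded by [noB]: a bad index
     outside [A m] leaves at a step [k <= m], and each of these finitely many sequences [H k] is at
     most [1 / (k + 1)] at [y] from some index on. *)
  pose B := [set i | ~ `|T i y| <= 1].
  have : F (~` B); last first.
    by apply: filterS => i /contrapT.
  apply: not_stationary => sB; apply: noB; exists B; split=> //.
    move=> i /= Bi; apply: contrapT => nIi; apply: Bi; rewrite /T /act.
    by case: asboolP => [[]//|_]; rewrite normr0.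
  move=> m.
  have [N NP] := choice (fun k => (HP k).2 y py).
  apply: (sub_finite_set _ (finite_II (\max_(k < m.+1) N k))) => i [Bi nAm] /=.
  rewrite ltnNge; apply/negP => Ni; apply: Bi; rewrite /T.
  case: ifP => [/asboolP [Ii nA]|_]; last by rewrite normr0.
  have kkm : (kk i < m.+1)%N.
    rewrite ltnS leqNgt; apply/negP => mk; apply: nAm.
    by case: (kkP i) => [[_ [_ h]]|[k0 _]]; [exact: h|rewrite k0 in mk].
  rewrite normrM ger0_norm// -ler_pdivlMl// mulr1; apply: NP.
  by apply: leq_trans Ni; exact: (leq_bigmax (Ordinal kkm)).
have [m Cm] : exists m : nat, C < m%:R.
  exists (Num.bound `|C|).
  exact: le_lt_trans (ler_norm C) (archi_boundP (normr_ge0 C)).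
(* An index of [J] that leaves after step [m] carries a functional of norm above [m], hence above
   [C]. So the elements of [J] in [A m] never leave. *)
apply: noB; exists (J `&` A m); split.
- exact: stationaryI.
- by move=> i [/JI].
move=> k; rewrite /almost_subset; suff -> : J `&` A m `\` A k = set0 by exact: finite_set0.
apply/seteqP; split=> // i [[Ji Am] nAk].
have Ii := JI _ Ji.
have nA : ~ A (kk i) i.
  by case: (kkP i) => [[_ []]//|[_ []//]]; move=> /(_ k).
have [h _] := HP (kk i); have [_ [y py hy]] := h i.
have := JC i y Ji; rewrite /T /act asboolT// normrM ger0_norm//.
have mk : (m < kk i)%N by rewrite ltnNge; apply/negP => km; apply: nA; exact: Ale Am.
have : (m%:R : R) <= (kk i).+1%:R by rewrite ler_nat ltnW// ltnW.
have := seminorm_ge0 y ps; move: hy.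
set K := _.+1%:R; set v := `|_| => v1 p0 mK Kv.
have : K * 1 <= K * v by rewrite ler_wpM2l//; apply: le_trans mK.
have K0 : 0 < K by rewrite ltr0n.
have [C0|C0] := leP 0 C; last by have : C * p y <= 0 by [rewrite nmulr_rle0]; lra.
have : C * p y <= C * 1 by rewrite ler_wpM2l.
lra.
Qed.

Lemma functional_uniform_boundedness_rapid_plus : rapid_plus_filter F.
Proof.
move=> I f sI flt; apply: contrapT => noB.
have fle : {homo f : m n / (m <= n)%N}.
  by move=> m n; rewrite leq_eqVlt => /orP[/eqP ->//|/flt /ltnW].
have fge n : (n <= f n)%N.
  by elim: n => // n IH; exact: leq_ltn_trans IH (flt _ _ (ltnSn n)).
(* [M m] is the sum of the squares up to [m ^ 2]; the square [m ^ 2] will bound the number of bad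
   indices in block [m]. *)
have [M [M0 MS]] : exists M : nat -> nat,
    M 0%N = 0%N /\ forall m, M m.+1 = (M m + m.+1 ^ 2)%N.
  by exists (fix M m := if m is m'.+1 then (M m' + m ^ 2)%N else 0%N).
have Mge m : (m <= M m)%N.
  elim: m => // m IH; rewrite MS.
  have : (0 < m.+1 ^ 2)%N by rewrite expn_gt0.
  by move: IH; lia.
have Mle : {homo M : m n / (m <= n)%N}.
  by apply: homo_leq leqnn leq_trans _ => m; rewrite MS leq_addr.
have exm i : exists m, (i < f (M m.+1))%N.
  by exists i; apply: leq_trans (fge _); exact: leq_trans (Mge _).
(* For [m > 0], block [m] runs from [f (M m)] to [f (M m.+1)], the latter excluded; block [0] is
   everything below [f (M 1)], and the weight there is [0]. *)
pose blk i := ex_minn (exm i).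
have blk_lt i : (i < f (M (blk i).+1))%N by rewrite /blk; case: ex_minnP.
have blk_min i m : (i < f (M m.+1))%N -> (blk i <= m)%N.
  by rewrite /blk; case: ex_minnP => l _; apply.
have exu m := dvoretzky_rogers ps (f (M m.+1)) large.
have [u uP] := choice exu.
pose wt i : R := if `[< I i >] then (blk i)%:R else 0.
pose T i y := wt i * u (blk i) i y.
have ui i : bounded_functional p (u (blk i) i) /\
    exists2 x, p x <= 1 & 8^-1 <= `|u (blk i) i x|.
  by have [h _] := uP (blk i); exact: h (blk_lt i).
have Tb i : bounded_functional p (T i).
  by apply: bounded_functionalZ; exact: (ui i).1.
have [|J [C [sJ JI JC]]] := ub Tb _ sI.
  apply: unit_ball_pointwise_bounded => [i|y py]; first exact: (Tb i).1.
  pose B := [set i | I i /\ ~ `|T i y| <= 1].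
  pose B' := [set i | ~ `|T i y| <= 1].
  have FB : F (~` B).
    apply: not_stationary => sB; apply: noB; exists B; split=> //.
      by move=> i [].
    have [eta etaP] := enumerates_infinite (stationary_infinite Ffree sB).
    exists eta => // n; rewrite leqNgt; apply/negP => etan.
    (* [b] counts the bad indices. The aim is [b (f n) <= n], because [eta n < f n] would put the
       [n + 1] indices [eta 0, ..., eta n] below [f n]. *)
    pose b k := (\sum_(i < k) `[< B i >])%N.
    have ble k l : (k <= l)%N -> (b k <= b l)%N.
      by move=> kl; rewrite /b -(subnKC kl) big_split_ord/= leq_addr.
    have bM m : (b (f (M m.+1)) <= M m)%N.
      elim: m => [|m IH].
        rewrite /b big1// => i _; apply/eqP; rewrite eqb0; apply/asboolPn.
        move=> [Ii]; apply; rewrite /T /wt asboolT//.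
        have := blk_min i 0%N (ltn_ord i); rewrite leqn0 => /eqP ->.
        by rewrite mul0r normr0.
      have fMM : (f (M m.+1) <= f (M m.+2))%N by apply: fle; exact: Mle.
      rewrite {1}/b -(subnKC fMM) big_split_ord/= [leqRHS]MS leq_add//.
      (* A bad index in block [m + 1] contributes at least [1] to the sum of the
         [(m + 1) ^ 2 * u_i(y) ^ 2], and the [u_i(y) ^ 2] add up to at most [1]. *)
      have [_ /(_ y) uy] := uP m.+1.
      rewrite -(ler_nat R) natr_sum.
      apply: (@le_trans _ _ (\sum_(i < f (M m.+2) - f (M m.+1))
          m.+1%:R ^+ 2 * u m.+1 (f (M m.+1) + i)%N y ^+ 2)).
        apply: ler_sum => i _; case: asboolP => [[Ii Ti]|_]; last first.
          by rewrite mulr_ge0// sqr_ge0.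
        have im : blk (f (M m.+1) + i) = m.+1.
          apply/eqP; rewrite eqn_leq blk_min/=; last first.
            by rewrite -[ltnRHS](subnKC fMM) ltn_add2l.
          rewrite ltnNge; apply/negP => bm.
          have := leq_trans (blk_lt (f (M m.+1) + i)%N) (fle _ _ (Mle _ _ (bm : (blk _).+1 <= m.+1)%N)).
          by rewrite ltnNge leq_addr.
        rewrite -exprMn -[leRHS]real_normK ?num_real//.
        move: Ti; rewrite /T /wt asboolT// im => /negP; rewrite -ltNge => /ltW.
        by move=> h; exact: (exprn_ege1 2 h).
      rewrite -mulr_sumr natrX -[leRHS]mulr1 ler_wpM2l ?sqr_ge0//.
      apply: (@le_trans _ _ (p y ^+ 2)); last first.
        by rewrite expr_le1// seminorm_ge0.
      have : \sum_(i < f (M m.+1) + (f (M m.+2) - f (M m.+1))) u m.+1 i y ^+ 2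
          <= p y ^+ 2 by rewrite subnKC.
      rewrite big_split_ord/=; apply: le_trans.
      by rewrite lerDr sumr_ge0// => i _; rewrite sqr_ge0.
    have bn : (b (f n) <= n)%N.
      have ex : exists m, (n < M m.+1)%N by exists n; exact: Mge.
      case: (ex_minnP ex) => m nm mmin.
      apply: (@leq_trans (M m)).
        by apply: leq_trans (bM m); apply: ble; rewrite fle// ltnW.
      case: m nm mmin => [|m] nm mmin; first by rewrite M0.
      by rewrite leqNgt; apply/negP => /mmin; rewrite ltnn.
    have : (n.+1 <= b (f n))%N; last by rewrite ltnNge bn.
    have [etalt etar] := etaP.
    have etale k : (k <= n)%N -> (eta k < f n)%N.
      rewrite leq_eqVlt => /orP[/eqP ->//|kn].
      exact: ltn_trans (etalt _ _ kn) etan.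
    pose g (k : 'I_n.+1) : 'I_(f n) := Ordinal (etale k (ltn_ord k)).
    have ginj : injective g.
      move=> k l /(congr1 val) /= kl; apply/val_inj => /=.
      by case: (ltngtP k l) => // /etalt; rewrite kl ltnn.
    have -> : b (f n) = #|[pred i : 'I_(f n) | `[< B i >]]|.
      rewrite -sum1_card big_mkcond /b; apply: eq_bigr => i _ /=.
      by rewrite inE; case: asboolP.
    rewrite -[X in (X <= _)%N]card_ord -(card_codom ginj).
    apply: subset_leq_card; apply/fintype.subsetP => _ /codomP[k ->].
    have : range eta (eta k) by exists (k : nat).
    by rewrite etar => Bk; apply/asboolP.
  apply: filterS FB => i nBi /=; apply: contrapT => nTi; apply: nBi; split=> //.
  apply: contrapT => nIi; apply: nTi.
  by rewrite /T /wt; case: asboolP => // _; rewrite mul0r normr0.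
(* The functionals in block [m] have norm at least [m / 8], and [J], being stationary, reaches
   beyond every block. *)
have [m Cm] : exists m : nat, 8 * C < m%:R.
  exists (Num.bound `|8 * C|).
  exact: le_lt_trans (ler_norm _) (archi_boundP (normr_ge0 _)).
have [i Ji mi] := stationary_ge Ffree (f (M m.+1)) sJ.
have mb : (m < blk i)%N.
  rewrite ltnNge; apply/negP => bm.
  have := leq_trans (blk_lt i) (fle _ _ (Mle _ _ (bm : (blk i).+1 <= m.+1)%N)).
  by rewrite ltnNge mi.
have [_ [y py hy]] := ui i.
have := JC i y Ji; rewrite /T /wt asboolT; last exact: JI.
rewrite normrM ger0_norm//.
have : (m%:R : R) <= (blk i)%:R by rewrite ler_nat ltnW.
have := seminorm_ge0 y ps; move: hy; set K := (blk i)%:R; set v := `|_|.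
move=> v1 p0 mK Kv.
have K0 : 0 <= K by rewrite ler0n.
have : K * 8^-1 <= K * v by rewrite ler_wpM2l.
have [C0|C0] := leP 0 C.
  have : C * p y <= C * 1 by rewrite ler_wpM2l.
  lra.
have : C * p y <= 0 by rewrite nmulr_rle0.
have : (0 : R) < K by rewrite ltr0n; exact: leq_ltn_trans mb.
lra.
Qed.

End NecessityForFunctionals.

(** * Necessity, for Banach spaces *)

Section FiniteDimension.
Context {K : numFieldType} {X : lmodType K} {n : nat} (Phi : {linear X -> 'rV[K]_n}).
Hypothesis Phi_inj : injective Phi.

(** A family of maximal length with independent images under [Phi] is a basis of [X]: by maximality
    the images span every [Phi y], and [Phi] is injective. *)
Lemma embedding_finite_dimensional : ~ infinite_dimensional X.
Proof.
move=> Xinf.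
pose P r := `[< exists x : 'I_r -> X, row_free (\matrix_i Phi (x i)) >].
have exP : exists r, P r.
  exists 0%N; apply/asboolP; exists (fun=> 0).
  by rewrite /row_free; have := rank_leq_row (\matrix_(i < 0) Phi 0); rewrite leqn0.
have Pn r : P r -> (r <= n)%N.
  by move/asboolP => [x]; rewrite /row_free => /eqP <-; exact: rank_leq_col.
case: (ex_maxnP exP Pn) => r /asboolP [x xfree] rmax.
set B := \matrix_i _ in xfree.
have span y : (Phi y <= B)%MS.
  apply: contrapT => /negP yB.
  have : P r.+1; last by move/rmax; rewrite ltnn.
  pose C : 'M[K]_(1 + r, n) := col_mx (Phi y) B.
  pose x' (i : 'I_(1 + r)) := if @fintype.split 1 r i is inr k then x k else y.
  have x'C : \matrix_i Phi (x' i) = C.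
    apply/matrixP => i l; rewrite mxE /C /x'.
    case: (split_ordP i) => k ->.
      by rewrite col_mxEu ord1.
    by rewrite col_mxEd mxE.
  suff Cfree : row_free C by apply/asboolP; exists x'; rewrite [X in row_free X]x'C.
  apply: inj_row_free => v; rewrite -[v]hsubmxK /C mul_row_col.
  set a := lsubmx v; set w := rsubmx v => aw0.
  have [a0|a0] := eqVneq (a 0 0) 0.
    have {}a0 : a = 0 by apply/matrixP => i j; rewrite !ord1 a0 mxE.
    move: aw0; rewrite a0 mul0mx add0r => /eqP.
    by rewrite mulmx_free_eq0// => /eqP ->; rewrite row_mx0.
  case/negP: yB; have -> : Phi y = - (a 0 0)^-1 *: (w *m B).
    have {}aw0 : w *m B = - (a *m Phi y) by apply/eqP; rewrite -addr_eq0 addrC aw0.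
    have aE : a *m Phi y = a 0 0 *: Phi y by rewrite {1}[a]mx11_scalar mul_scalar_mx.
    rewrite aw0 aE scalerN scaleNr opprK scalerA.
    by rewrite mulVf// scale1r.
  by rewrite scalemx_sub// submxMl.
pose g (w : 'rV[K]_r) : X := \sum_i w 0 i *: x i.
have Phig w : Phi (g w) = w *m B.
  rewrite /g linear_sum mulmx_sum_row; apply: eq_bigr => i _.
  by rewrite linearZ rowK.
apply: (Xinf r); exists (fun y => Phi y *m pinvmx B).
  by move=> a y z; rewrite linearP mulmxDl -scalemxAl.
exists g => [y|w]; last by rewrite Phig mulmxKp.
by apply: Phi_inj; rewrite Phig mulmxKpV.
Qed.

End FiniteDimension.

(* [X] with its scalars restricted along [io]. *)
Definition realified (R : realType) (K : numFieldType)
  (io : {rmorphism R -> K}) (X : lmodType K) : Type := X.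

Section Realified.
Context {R : realType} {K : numFieldType} (io : {rmorphism R -> K}).
Context {X : lmodType K}.
Local Notation XR := (realified io X).

HB.instance Definition _ := GRing.Zmodule.on XR.

Definition real_scale (a : R) (x : XR) : XR := io a *: (x : X).

Lemma real_scaleA a b x : real_scale a (real_scale b x) = real_scale (a * b) x.
Proof. by rewrite /real_scale scalerA rmorphM. Qed.

Lemma real_scale1 : left_id 1 real_scale.
Proof. by move=> x; rewrite /real_scale rmorph1 scale1r. Qed.

Lemma real_scaleDr : right_distributive real_scale +%R.
Proof. by move=> a x y; rewrite /real_scale scalerDr. Qed.

Lemma real_scaleDl x : {morph real_scale^~ x : a b / a + b}.
Proof. by move=> a b; rewrite /real_scale rmorphD scalerDl. Qed.

HB.instance Definition _ := GRing.Zmodule_isLmodule.Build R XR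
  real_scaleA real_scale1 real_scaleDr real_scaleDl.

Lemma real_scaleE a (x : XR) : a *: x = io a *: (x : X).
Proof. by []. Qed.

End Realified.

(** * Banach spaces over [K], where [io] embeds the reals and [nm] is the real modulus *)

Section NecessityForBanach.
Context {R : realType} {K : numFieldType} (io : {rmorphism R -> K}) (nm : K -> R).
Hypothesis nmE : forall z, `|z| = io (nm z).
Hypothesis io_ge0 : forall a, 0 <= a -> 0 <= io a.

Lemma ler_io a b : (io a <= io b) = (a <= b).
Proof.
have le_io c d : c <= d -> io c <= io d.
  by move=> cd; rewrite -subr_ge0 -rmorphB io_ge0// subr_ge0.
apply/idP/idP => [|/le_io//]; apply: contraTT; rewrite -ltNge => ba.
apply/negP => ab; have := le_io _ _ (ltW ba) => ba'.
have /fmorph_inj abE : io a = io b by apply/eqP; rewrite eq_le ab.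
by rewrite abE ltxx in ba.
Qed.

Lemma ltr_io a b : (io a < io b) = (a < b).
Proof. by rewrite !lt_def ler_io (inj_eq (@fmorph_inj _ _ io)). Qed.

Lemma nm_ge0 z : 0 <= nm z.
Proof. by rewrite -ler_io rmorph0 -nmE. Qed.

Lemma nm_io a : nm (io a) = `|a|.
Proof.
apply: (@fmorph_inj _ _ io); rewrite -nmE.
have [a0|a0] := leP 0 a; first by rewrite !ger0_norm ?io_ge0.
rewrite [in RHS]ltr0_norm// rmorphN ler0_norm//.
by rewrite -[X in _ <= X](rmorph0 io) ler_io ltW.
Qed.

Lemma nm_pos (t : K) : 0 < t -> t = io (nm t).
Proof. by move=> t0; rewrite -nmE gtr0_norm. Qed.

Lemma nm_le z w : (nm z <= nm w) = (`|z| <= `|w|).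
Proof. by rewrite !nmE ler_io. Qed.

Section RealNorm.
Context {X : normedModType K}.

Definition rnorm (x : X) : R := nm `|x|.

Lemma rnormE x : `|x| = io (rnorm x).
Proof. by rewrite /rnorm -nmE normr_id. Qed.

Lemma rnorm_seminorm : seminorm (rnorm : realified io X -> R).
Proof.
split=> [x y|a x].
  by rewrite -ler_io rmorphD -!rnormE ler_normD.
apply: (@fmorph_inj _ _ io).
by rewrite rmorphM -!rnormE real_scaleE normrZ nmE nm_io.
Qed.

Lemma rnorm0_eq0 x : rnorm x = 0 -> x = 0.
Proof. by move=> x0; apply/eqP; rewrite -normr_eq0 rnormE x0 rmorph0. Qed.

End RealNorm.

(* Over the complex numbers, [T x] will be [u x - i u (i x)]. *)
Definition complexifiable : Prop := forall X : normedModType K,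
  exists2 j : X -> X, forall x, `|j x| = `|x| &
    forall u : realified io X -> R, linear_functional u ->
    exists T : {linear X -> K^o}, forall x,
      `|u x| <= nm (T x) /\ nm (T x) <= `|u x| + `|u (j x)|.

Hypothesis cplx : complexifiable.

(** Otherwise the [K]-linear maps attached to finitely many real functionals would have trivial
    common kernel and embed [X] into a space of row vectors. *)
Lemma dual_infinite_rnorm (X : normedModType K) :
  infinite_dimensional X -> dual_infinite (rnorm : realified io X -> R).
Proof.
move=> Xinf n f fb; apply: contrapT => nox.
have [j _ jP] := cplx X.
have [T TP] := choice (fun i => jP _ (fb i).1).
pose Phi x : 'rV[K]_n := \row_i T i x.
have Phil : linear Phi.
  by move=> a x y; apply/matrixP => i k; rewrite !mxE linearP.
pose PhiL := GRing.isLinear.Build _ _ _ _ Phi Phil.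
pose PhiL' : {linear X -> 'rV[K]_n} := HB.pack Phi PhiL.
apply: (@embedding_finite_dimensional K X n PhiL') => // x y xy.
apply/eqP; rewrite -subr_eq0; apply/eqP.
have : PhiL' (x - y) = 0 by rewrite linearB xy subrr.
move: (x - y) => {y xy}x Px; apply: rnorm0_eq0.
apply/eqP/negPn/negP => px0.
have ps := @rnorm_seminorm X.
have p0 : 0 < rnorm x by rewrite lt_def px0 (seminorm_ge0 (x : realified io X) ps).
apply: nox; exists ((rnorm x)^-1 *: (x : realified io X)).
  by rewrite ps.2 ger0_norm ?mulVf// invr_ge0 ltW.
move=> i ni; rewrite (linear_functionalZ (fb i).1).
suff -> : f i x = 0 by rewrite mulr0.
apply/eqP; rewrite -normr_le0; have [+ _] := TP i x.
move/le_trans; apply.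
have /matrixP /(_ 0 (Ordinal ni)) := Px.
rewrite !mxE /= => ->.
by rewrite -[X in nm X](rmorph0 io) nm_io normr0.
Qed.

Lemma bounded_linear_continuousK (X : normedModType K) (T : {linear X -> K^o}) (C : R) :
  (forall x, nm (T x) <= C * rnorm x) -> continuous T.
Proof.
move=> TC x; apply/cvgrPdist_lt => e e0.
pose D : K := io (`|C| + 1).
have D0 : 0 < D by rewrite -(rmorph0 io) ltr_io ltr_wpDl.
have De0 : 0 < e / D by rewrite divr_gt0.
near=> y.
rewrite -linearB nmE.
apply: (@le_lt_trans _ _ (D * `|x - y|)).
  rewrite rnormE -rmorphM ler_io (le_trans (TC _))// ler_wpM2r ?nm_ge0//.
  by rewrite (le_trans (ler_norm C))// lerDl.
rewrite mulrC -ltr_pdivlMr//.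
Unshelve. all: by end_near. Qed.

(** The principle is used with target [K], for the [K]-linear maps attached to the real functionals;
    the two-sided comparison in [complexifiable] carries bounds both ways. *)
Lemma functional_ub_of_stationary_ub (F : set_system nat) (FF : ProperFilter F)
    (X : normedModType K) : stationary_uniform_boundedness F X ->
  functional_uniform_boundedness F (rnorm : realified io X -> R).
Proof.
move=> sub u ub ubnd I sI.
have [j jn jP] := cplx X.
have [T TP] := choice (fun i => jP _ (ub i).1).
have jr x : rnorm (j x) = rnorm x by rewrite /rnorm jn.
have Tc i : continuous (T i).
  have [_ [C uC]] := ub i.
  apply: (@bounded_linear_continuousK _ _ (C + C)) => x.
  have [_ h] := TP i x; apply: (le_trans h).
  by rewrite mulrDl; apply: lerD; [exact: uC|rewrite -(jr x); exact: uC].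
have Tb : pointwise_F_bounded F T.
  move=> x W W0.
  have [C FC] := ubnd x; have [D FD] := ubnd (j x).
  have /nbhs_ballP [e /= e0 eW] : nbhs (0 : K^o) W by [].
  have C0 : 0 < `|C| + `|D| + 1 by rewrite ltr_wpDl// addr_ge0.
  pose t : K := e / io (`|C| + `|D| + 1).
  have t0 : 0 < t by rewrite divr_gt0// -(rmorph0 io) ltr_io.
  exists t => //; apply: filterS (filterI FC FD) => i [/= uC uD].
  apply: eW; rewrite /ball /= sub0r normrN normrM gtr0_norm// nmE.
  rewrite /t mulrAC ltr_pdivrMr ?ltr_pM2l ?ltr_io// -?(rmorph0 io) ?ltr_io//.
  have [_ h] := TP i x; apply: (le_lt_trans h).
  have := ler_norm C; have := ler_norm D; lra.
have W0 : nbhs (0 : K^o) (ball (0 : K^o) 1) by exact: nbhsx_ballx.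
have [U [J [U0 sJ JI JU]]] := sub _ T Tc Tb I _ sI W0.
have /nbhs_ballP [e /= e0 eU] := U0.
pose r := nm e; have er : e = io r by exact: nm_pos.
have r0 : 0 < r by rewrite -ltr_io rmorph0 -er.
(* [U] contains the open ball of radius [r]; vectors are scaled to norm [r / 2] to lie inside it,
   whence the factor [2]. *)
exists J, (2 / r); split=> // i x Ji.
have [h _] := TP i x; apply: (le_trans h) => {h}.
have [x0|x0] := eqVneq (rnorm x) 0.
  rewrite (rnorm0_eq0 x0) linear0 -[X in nm X](rmorph0 io) nm_io normr0.
  by rewrite mulr_ge0 ?nm_ge0// divr_ge0// ltW.
have px0 : 0 < rnorm x by rewrite lt_def x0 nm_ge0.
pose c := r / (2 * rnorm x); have c0 : 0 < c by rewrite divr_gt0// mulr_gt0.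
have : ball (0 : K^o) 1 (T i (io c *: x)).
  apply: (JU i Ji); exists (io c *: x) => //; apply: eU.
  rewrite -ball_normE /= sub0r normrN normrZ nmE nm_io rnormE -rmorphM er ltr_io.
  rewrite gtr0_norm// /c.
  have -> : r / (2 * rnorm x) * rnorm x = r / 2 by field.
  lra.
rewrite /ball /= sub0r normrN linearZ normrM !nmE nm_io -rmorphM.
rewrite -(rmorph1 io) ltr_io gtr0_norm// /c => h.
have -> : 2 / r * rnorm x = (r / (2 * rnorm x))^-1 by field; rewrite x0 gt_eqF.
rewrite -[leRHS]mulr1 -ler_pdivrMl ?invr_gt0// invrK; exact: ltW.
Qed.

Theorem stationary_ub_infinite_dimensional (F : set_system nat)
    (FF : ProperFilter F) (Ffree : free_filter F) (X : normedModType K) :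
  infinite_dimensional X -> stationary_uniform_boundedness F X ->
  rapid_plus_filter F /\ weak_Pplus_filter F.
Proof.
move=> Xinf sub; have ps := @rnorm_seminorm X.
have large := dual_infinite_rnorm Xinf.
have ub := functional_ub_of_stationary_ub FF sub.
split.
  exact: (functional_uniform_boundedness_rapid_plus FF Ffree ps large ub).
exact: (functional_uniform_boundedness_weak_Pplus FF ps large ub).
Qed.

End NecessityForBanach.

(** * Linear maps over the scalars attached to real functionals *)

Section RealAndComplexScalars.
Context {R : realType}.

Lemma complexifiable_real :
  @complexifiable R (R : numFieldType) (idfun : {rmorphism R -> R}) (fun z : R => `|z|).
Proof.
move=> X; exists id => // u ul.
have uL : linear (u : X -> R^o) by exact: ul.
pose uLb := GRing.isLinear.Build _ _ _ _ (u : X -> R^o) uL.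
pose T : {linear X -> R^o} := HB.pack (u : X -> R^o) uLb.
by exists T => x; split=> //; rewrite lerDl.
Qed.

Definition complex_modulus (z : R[i]) : R := Num.sqrt (complex.Re z ^+ 2 + complex.Im z ^+ 2).

Lemma complex_modulus_ge (z : R[i]) : `|complex.Re z| <= complex_modulus z.
Proof. by rewrite -sqrtr_sqr ler_sqrt ?addr_ge0 ?sqr_ge0// lerDl sqr_ge0. Qed.

Lemma complex_modulus_ge_Im (z : R[i]) : `|complex.Im z| <= complex_modulus z.
Proof. by rewrite -sqrtr_sqr ler_sqrt ?addr_ge0 ?sqr_ge0// lerDr sqr_ge0. Qed.

Lemma complex_modulus_le (z : R[i]) : complex_modulus z <= `|complex.Re z| + `|complex.Im z|.
Proof.
rewrite -[leRHS]ger0_norm ?addr_ge0// -sqrtr_sqr ler_sqrt ?sqr_ge0//.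
rewrite -(real_normK (num_real (complex.Re z))) -(real_normK (num_real (complex.Im z))).
by rewrite sqrrD -addrA lerD// lerDr mulrn_wge0// mulr_ge0.
Qed.

Lemma complexifiable_complex :
  @complexifiable R (R[i] : numFieldType) (real_complex R : {rmorphism R -> R[i]})
    complex_modulus.
Proof.
move=> X; exists (fun x => 'i%C *: x).
  by move=> x; rewrite normrZ normc_def /= expr0n expr1n add0r sqrtr1 mul1r.
move=> u ul.
pose f (x : X) : (R[i])^o := (u x -i* u ('i%C *: x))%C.
have fl : linear f.
  have uD (v w : X) : u (v + w) = u v + u w := linear_functionalD ul v w.
  have uZ (c : R) (v : X) : u (c%:C%C *: v) = c * u v := linear_functionalZ ul c v.
  move=> [a b] x y.
  have e1 : (a +i* b)%C *: x = a%:C%C *: x + b%:C%C *: ('i%C *: x).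
    rewrite scalerA -scalerDl; congr (_ *: _).
    by apply/eqP; rewrite eq_complex /=; apply/andP; split; apply/eqP; ring.
  have e2 : 'i%C *: ((a +i* b)%C *: x + y) =
      a%:C%C *: ('i%C *: x) + ((- b)%:C%C *: x + 'i%C *: y).
    rewrite scalerDr addrA; congr (_ + _).
    rewrite !scalerA -scalerDl; congr (_ *: _).
    by apply/eqP; rewrite eq_complex /=; apply/andP; split; apply/eqP; ring.
  rewrite /f e2 e1 !uD !uZ /=; apply/eqP; rewrite eq_complex /=.
  by apply/andP; split; apply/eqP; ring.
pose fLb := GRing.isLinear.Build _ _ _ _ f fl.
pose T : {linear X -> (R[i])^o} := HB.pack f fLb.
exists T => x; split; first exact: (complex_modulus_ge (f x)).
by have := complex_modulus_le (f x); rewrite /f /= normrN.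
Qed.

End RealAndComplexScalars.

(** * Sufficiency *)

Section GlidingHump.
Context {R : realType} {V : lmodType R}.

Lemma eventually_le1_max (a : nat -> R) N n : (forall l, (N <= l)%N -> a l <= 1) ->
  1 < a n -> exists m, forall l, a l <= a m.
Proof.
move=> aN an.
pose i0 : 'I_(maxn N n).+1 := inord n.
case: (@arg_maxP _ _ _ i0 xpredT (fun i => a i)) => // m _ mmax.
have nm : a n <= a m.
  have := mmax i0 isT; rewrite /i0 inordK// ltnS leq_maxr//.
exists m => l; have [lN|Nl] := ltnP l (maxn N n).+1.
  by have := mmax (Ordinal lN) isT.
apply: le_trans (aN _ _) (ltW (lt_le_trans an nm)).
by rewrite (leq_trans _ (ltnW Nl))// leq_maxl.
Qed.

Variables (q : nat -> V -> R) (w : nat -> V).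
Hypothesis qs : forall n, seminorm (q n).
Hypothesis q_max : forall n l, q n (w l) <= q n (w n).

Definition hump n : V := 4^-1 ^+ n *: w n.

(** The hump number [l] adds at most [C * 4 ^ (- l)], and [4 / 3] comes from summing this geometric
    series. *)
Lemma q_sum_tail (r : V -> R) (s : nat -> V) C : seminorm r ->
  (forall l, r (w l) <= C) ->
  (forall n, s n.+1 = s n \/ s n.+1 = s n + hump n) ->
  forall n k, r (s (n + k)%N - s n) <=
    C * (4 / 3) * (4^-1 ^+ n - 4^-1 ^+ (n + k)).
Proof.
move=> rs rw sS n; elim=> [|k IH]; first by rewrite addn0 !subrr seminorm0// mulr0.
have C0 : 0 <= C by apply: le_trans (rw 0%N); exact: seminorm_ge0.
have step : r (s (n + k.+1)%N - s n) <= r (s (n + k)%N - s n) + 4^-1 ^+ (n + k) * C.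
  have h0 : 0 <= (4^-1 : R) ^+ (n + k) by rewrite exprn_ge0// invr_ge0.
  rewrite addnS; case: (sS (n + k)%N) => ->.
    by rewrite lerDl mulr_ge0.
  rewrite addrAC (le_trans (rs.1 _ _))// lerD2l /hump rs.2 ger0_norm//.
  by rewrite ler_wpM2l.
apply: (le_trans step); rewrite addnS exprS.
move: IH; set A := _ ^+ n; set B := _ ^+ (n + k); lra.
Qed.

Lemma gliding_hump :
  (forall s : nat -> V, (forall n, s n.+1 = s n \/ s n.+1 = s n + hump n) ->
    exists x, forall n e, 0 < e -> exists N, forall k, (N <= k)%N ->
      q n (x - s k) <= e) ->
  exists x, forall n, 4^-1 ^+ n * q n (w n) / 6 <= q n x.
Proof.
move=> complete.
pose s := fix s n := if n is n'.+1 then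
  if q n' (s n') < q n' (hump n') / 2 then s n' + hump n' else s n' else 0.
have sS n : s n.+1 = s n \/ s n.+1 = s n + hump n.
  by rewrite /=; case: ifP; [right|left].
have sq n : q n (hump n) / 2 <= q n (s n.+1).
  rewrite /=; case: ltP => // h.
  have := seminormB (s n + hump n) (s n) (qs n); rewrite addrAC subrr add0r; lra.
have [x xs] := complete s sS; exists x => n; apply/ler_addgt0Pr => e e0.
have [N hN] := xs n e e0.
have := hN (n.+1 + N)%N (leq_addl _ _).
have := q_sum_tail (qs n) (q_max n) sS n.+1 N.
have := sq n.
have h4 : 0 <= (4^-1 : R) ^+ n by rewrite exprn_ge0// invr_ge0.
have -> : q n (hump n) = 4^-1 ^+ n * q n (w n) by rewrite /hump (qs n).2 ger0_norm.
have tri : q n (s n.+1) <= q n x + q n (x - s (n.+1 + N)%N) +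
    q n (s (n.+1 + N)%N - s n.+1).
  have sE : s n.+1 = x - (x - s (n.+1 + N)%N) - (s (n.+1 + N)%N - s n.+1).
    by rewrite !subKr.
  rewrite {1}sE (le_trans (seminormB _ _ (qs n)))// lerD2r.
  exact: seminormB.
move: tri; have h5 : 0 <= (4^-1 : R) ^+ (n.+1 + N) by rewrite exprn_ge0// invr_ge0.
have Q0 := seminorm_ge0 (w n) (qs n).
have : 0 <= q n (w n) * 4^-1 ^+ (n.+1 + N) by rewrite mulr_ge0.
move: h4 h5; rewrite (exprS _ n).
set A := _ ^+ n; set B := _ ^+ (n.+1 + N); set Q := q n (w n).
set a := q n (s n.+1); set b := q n (x - _); set c := q n (_ - _).
have : A * Q = Q * A by rewrite mulrC.
lra.
Qed.

End GlidingHump.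

(** * Continuous seminorms of a locally convex space *)

Section Gauge.
Context {R : realType} {K : numFieldType} (io : {rmorphism R -> K}) (nm : K -> R).
Hypothesis nmE : forall z, `|z| = io (nm z).
Hypothesis io_ge0 : forall a, 0 <= a -> 0 <= io a.
Context {Y : tvsType K}.

Lemma convex_nbhs0 (V : set Y) : nbhs 0 V -> exists C : set Y,
  [/\ nbhs 0 C, C `<=` V & forall (a : R) x y, 0 <= a -> a <= 1 -> C x -> C y ->
    C (io a *: x + io (1 - a) *: y)].
Proof.
move=> V0.
have [B Bconv [Bopen Bbasis]] := @locally_convex K Y.
have [C [BC C0] CV] := Bbasis 0 V V0.
exists C; split=> //; first by apply: open_nbhs_nbhs; split=> //; exact: Bopen.
move=> a x y a0 a1 Cx Cy.
have ia0 : 0 <= io a by exact: io_ge0.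
have ia1 : io a <= 1 by rewrite -(rmorph1 io) (ler_io io_ge0).
have := Bconv C (mem_set BC) x y (Itv01 ia0 ia1) (mem_set Cx) (mem_set Cy).
by rewrite inE rmorphB rmorph1.
Qed.

Lemma scale_nbhs0 (W : set Y) (c : K) : nbhs 0 W -> nbhs 0 [set y | W (c *: y)].
Proof.
move=> W0; have := @scale_continuous K Y (c, 0) W; rewrite /= scaler0 => /(_ W0).
move=> [[A B] /= [A0 B0] AB]; apply: filterS B0 => y By.
by apply: (AB (c, y)); split=> //=; exact: nbhs_singleton.
Qed.

Lemma absorbing_nbhs0 (W : set Y) y : nbhs 0 W ->
  exists2 t : R, 0 < t & W (io t^-1 *: y).
Proof.
move=> W0; have := @scale_continuous K Y (0, y) W; rewrite /= scale0r => /(_ W0).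
move=> [[A B] /= [A0 By] AB].
have /nbhs_ballP [e /= e0 eA] := A0.
have ne0 : 0 < nm e by rewrite -(ltr_io io_ge0) rmorph0 -(nm_pos nmE e0).
exists ((nm e / 2)^-1); first by rewrite invr_gt0 divr_gt0.
rewrite invrK; apply: (AB (io (nm e / 2), y)); split=> /=.
  apply: eA; rewrite /ball /= sub0r normrN nmE (nm_io nmE io_ge0).
  rewrite [X in _ < X](nm_pos nmE e0) (ltr_io io_ge0) ger0_norm ?divr_ge0 ?ltW//.
  by rewrite ltr_pdivrMr// ltr_pMr// ltr1n.
exact: nbhs_singleton.
Qed.

(* The Minkowski functional of a symmetric convex neighbourhood of [0]. *)
Lemma gauge_seminorm (V : set Y) : nbhs 0 V -> exists p : Y -> R,
  [/\ seminorm (p : realified io Y -> R), nbhs 0 [set y | p y <= 1] &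
    forall y, p y < 1 -> V y].
Proof.
move=> V0; have [C [C0 CV Cconv]] := convex_nbhs0 V0.
(* Symmetry under [y |-> - y] is enough, because the gauge is a seminorm for real scalars. *)
pose W : set Y := [set y | C y /\ C (- y)].
have W0 : nbhs 0 W.
  apply: filterI => //; have := scale_nbhs0 (-1) C0.
  by apply: filterS => y /=; rewrite scaleN1r.
have WV : W `<=` V by move=> y [/CV].
have Wconv (a : R) x y : 0 <= a -> a <= 1 -> W x -> W y ->
    W (io a *: x + io (1 - a) *: y).
  move=> a0 a1 [Cx Cx'] [Cy Cy']; split; first exact: Cconv.
  by rewrite opprD -!scalerN; exact: Cconv.
have WN y : W y -> W (- y) by move=> [? ?]; split; rewrite ?opprK.
have W00 : W 0 := nbhs_singleton W0.
have Wshrink (a : R) y : 0 <= a -> a <= 1 -> W y -> W (io a *: y).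
  move=> a0 a1 Wy; have := Wconv a y 0 a0 a1 Wy W00.
  by rewrite scaler0 addr0.
pose S y := [set t : R | 0 < t /\ W (io t^-1 *: y)].
have S0 y : S y !=set0 by have [t t0 Wt] := absorbing_nbhs0 y W0; exists t.
have Slb y : lbound (S y) 0 by move=> t [/ltW].
have Shl y : has_lbound (S y) by exists 0; exact: Slb.
have Shi y : has_inf (S y) by split.
pose p y := inf (S y).
have p_ge0 y : 0 <= p y by apply: lb_le_inf.
have pD x y : p (x + y) <= p x + p y.
  apply/ler_addgt0Pr => e e0; have e20 : 0 < e / 2 by lra.
  have [s [s0 Ws] hs] := inf_adherent e20 (Shi x).
  have [t [t0 Wt] ht] := inf_adherent e20 (Shi y).
  have st0 : 0 < s + t by rewrite addr_gt0.
  apply: (@le_trans _ _ (s + t)); last by rewrite /p; move: hs ht; lra.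
  apply: ge_inf => //; split=> //.
  have := Wconv (s / (s + t)) _ _ _ _ Ws Wt.
  rewrite !scalerA -!rmorphM.
  have -> : s / (s + t) * s^-1 = (s + t)^-1 by field; rewrite !gt_eqF.
  have -> : (1 - s / (s + t)) * t^-1 = (s + t)^-1 by field; rewrite !gt_eqF.
  rewrite -scalerDr; apply; first by rewrite divr_ge0// ltW.
  by rewrite ler_pdivrMr// mul1r lerDl ltW.
have pN y : p (- y) = p y.
  rewrite /p; congr inf; apply/seteqP; split=> t [t0 Wt]; split=> //.
    by have := WN _ Wt; rewrite scalerN opprK.
  by rewrite scalerN; exact: WN.
have p0 : p 0 = 0.
  apply/eqP; rewrite eq_le p_ge0 andbT; apply/ler_addgt0Pr => e e0.
  by rewrite add0r; apply: ge_inf => //; split=> //; rewrite scaler0.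
have pZ (a : R) y : 0 < a -> p (io a *: y) <= a * p y.
  move=> a0; rewrite -ler_pdivrMl//; apply: lb_le_inf => // t [t0 Wt].
  rewrite ler_pdivrMl//; apply: ge_inf => //; split; first exact: mulr_gt0.
  by rewrite scalerA -rmorphM invfM mulrAC mulVf ?mul1r// gt_eqF.
exists p; split.
- split=> // a x; rewrite real_scaleE.
  have pos (c : R) y : 0 < c -> p (io c *: y) = c * p y.
    move=> c0; apply/eqP; rewrite eq_le pZ//=.
    have := @pZ c^-1 (io c *: y); rewrite invr_gt0 => /(_ c0).
    by rewrite scalerA -rmorphM mulVf ?gt_eqF// rmorph1 scale1r ler_pdivlMl.
  have [a0|a0|->] := ltgtP a 0.
  + by rewrite -pN -scaleNr -rmorphN pos ?oppr_gt0// ltr0_norm.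
  + by rewrite pos// gtr0_norm.
  + by rewrite rmorph0 scale0r p0 normr0 mul0r.
- apply: filterS W0 => y Wy /=; apply: ge_inf => //; split=> //.
  by rewrite invr1 rmorph1 scale1r.
- move=> y y1; have e0 : 0 < 1 - p y by lra.
  have [t [t0 Wt] ht] := inf_adherent e0 (Shi y); apply: WV.
  have {}ht : t < 1 by move: ht; rewrite -/(p y); lra.
  have := Wshrink t _ (ltW t0) (ltW ht) Wt.
  by rewrite scalerA -rmorphM mulfV ?gt_eqF// rmorph1 scale1r.
Qed.

End Gauge.

Section Sufficiency.
Context {R : realType} {K : numFieldType} (io : {rmorphism R -> K}) (nm : K -> R).
Hypothesis nmE : forall z, `|z| = io (nm z).
Hypothesis io_ge0 : forall a, 0 <= a -> 0 <= io a.

Lemma seminorm_comp_linear (X Y : lmodType K) (T : {linear X -> Y}) (p : Y -> R) :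
  seminorm (p : realified io Y -> R) ->
  seminorm ((fun x => p (T x)) : realified io X -> R).
Proof.
move=> ps; split=> [x y|a x].
  by have := ps.1 (T x) (T y); rewrite -[in X in X -> _]linearD.
have := ps.2 a (T x); rewrite !real_scaleE => <-.
by rewrite linearZ.
Qed.

Lemma strictly_increasing_above (N : nat -> nat) :
  exists2 f : nat -> nat, {homo f : m n / (m < n)%N} & forall n, (N n <= f n)%N.
Proof.
pose f := fix f n := if n is n'.+1 then ((f n').+1 + N n)%N else N 0%N.
exists f; last by case=> //= n; exact: leq_addl.
by apply: homo_ltn; [exact: ltn_trans|move=> n /=; exact: leq_addr].
Qed.

Lemma almost_subset_bound (A B : set nat) : almost_subset A B ->
  exists N, forall i, A i -> (N <= i)%N -> B i.
Proof.
move=> /finite_seqP [s sE]; exists (\max_(i <- s) i).+1 => i Ai Ni.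
apply: contrapT => nBi; have : (A `\` B) i by [].
rewrite sE /= => si; have := @leq_bigmax_seq _ s xpredT id i si isT.
by rewrite leqNgt Ni.
Qed.

Section Frechet.
Context {X : tvsType K} (d : X -> X -> R).
Hypothesis dtrans : forall x y z, d (x + z) (y + z) = d x y.
Hypothesis dsym : forall x y, d x y = d y x.
Hypothesis dnbhs : forall x, nbhs x =
  filter_from [set e : R | 0 < e] (fun e => [set y | d x y < e]).

Lemma dB x y : d x y = d 0 (y - x).
Proof. by rewrite -(dtrans 0 (y - x) x) add0r subrK. Qed.

Lemma dist_nbhs0 (W : set X) : nbhs 0 W ->
  exists2 e, 0 < e & forall y, d 0 y < e -> W y.
Proof. by rewrite dnbhs => -[e /= e0 eW]; exists e. Qed.

Lemma nbhs0_dist e : 0 < e -> nbhs 0 [set y : X | d 0 y < e].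
Proof. by move=> e0; rewrite dnbhs; exists e. Qed.

Lemma seminorm_small (q : X -> R) : seminorm (q : realified io X -> R) ->
  nbhs 0 [set y | q y <= 1] -> forall e, 0 < e ->
  exists2 r, 0 < r & forall y, d 0 y < r -> q y <= e.
Proof.
move=> qs q1 e e0; apply: (@dist_nbhs0 [set y | q y <= e]).
apply: filterS (scale_nbhs0 (io e^-1) q1) => y /=.
have /= := qs.2 e^-1 y; rewrite real_scaleE => ->.
by rewrite ger0_norm ?invr_ge0 ?(ltW e0)// ler_pdivrMl// mulr1.
Qed.

Hypothesis dcomplete : forall u : nat -> X,
  (forall e, 0 < e -> exists N, forall m n,
      (N <= m)%N -> (N <= n)%N -> d (u m) (u n) < e) ->
  exists l : X, u @ \oo --> l.

(** Every ball around [0] contains the set [p < 1] of some continuous seminorm [p]. Such a [p] is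
    bounded on the null sequence [w], so the tails of the hump sums are dominated by a geometric
    series, whichever indices [m n] occur. *)
Lemma frechet_complete (w : nat -> X) :
  (forall e, 0 < e -> exists N, forall n, (N <= n)%N -> d 0 (w n) < e) ->
  forall (m : nat -> nat) (s : nat -> X),
  (forall n, s n.+1 = s n \/
     s n.+1 = s n + hump (fun n => w (m n) : realified io X) n) ->
  exists x, forall e, 0 < e -> exists N, forall k, (N <= k)%N -> d 0 (x - s k) < e.
Proof.
move=> w0 m s sS.
have [e e0|x sx] := dcomplete (u := s).
  have [p [ps p1 pe]] := gauge_seminorm nmE io_ge0 (nbhs0_dist e0).
  have [r r0 rp] := seminorm_small ps p1 ltr01.
  have [N hN] := w0 r r0.
  have [C pC] : exists C, forall l, p (w l) <= C.
    exists (1 + \sum_(i < N) p (w i)) => l.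
    have sum0 : 0 <= \sum_(i < N) p (w i).
      by apply: sumr_ge0 => i _; exact: (seminorm_ge0 (w i : realified io X) ps).
    have [lN|Nl] := ltnP l N; last by have := rp _ (hN l Nl); lra.
    rewrite (bigD1 (Ordinal lN))//= addrCA lerDl addr_ge0// sumr_ge0// => i _.
    exact: (seminorm_ge0 (w i : realified io X) ps).
  have C0 : 0 <= C.
    exact: le_trans (seminorm_ge0 (w 0%N : realified io X) ps) (pC 0%N).
  have [M hM] : exists M, C * (4 / 3) * 4^-1 ^+ M < 1.
    pose D := C * (4 / 3) + 1; have D0 : 0 < D by rewrite /D; lra.
    exists (Num.bound D).
    have DM : D < 4 ^+ Num.bound D.
      apply: lt_trans (archi_boundP (ltW D0)) _.
      by rewrite -natrX ltr_nat ltn_expl.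
    rewrite exprVn ltr_pdivrMr ?exprn_gt0// mul1r.
    by apply: le_lt_trans DM; rewrite /D lerDl.
  exists M => i j; wlog ij : i j / (i <= j)%N.
    move=> h Mi Mj; have [ij|/ltnW ji] := leqP i j; first exact: h.
    by rewrite dsym; exact: h.
  move=> Mi Mj; rewrite dB; apply: pe.
  have := q_sum_tail ps (fun l => pC (m l)) sS i (j - i); rewrite subnKC//.
  move/le_lt_trans; apply; apply: le_lt_trans hM.
  rewrite ler_wpM2l ?mulr_ge0 ?divr_ge0//.
  have : 0 <= (4^-1 : R) ^+ j by rewrite exprn_ge0 ?invr_ge0.
  have : (4^-1 : R) ^+ i <= 4^-1 ^+ M.
    by rewrite ler_wiXn2l// ?invr_ge0// invf_le1// ler1n.
  lra.
exists x => e e0.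
have : nbhs x [set y | d x y < e] by rewrite dnbhs; exists e.
move/sx => -[N _ hN]; exists N => k Nk; have := hN k Nk => /=.
by rewrite dsym dB.
Qed.

Theorem stationary_ub_frechet (F : set_system nat) (FF : ProperFilter F)
    (Ffree : free_filter F) : rapid_plus_filter F -> weak_Pplus_filter F ->
  stationary_uniform_boundedness F X.
Proof.
move=> rap wP Y T Tc Tb I V sI V0.
have [p [ps p1 pV]] := gauge_seminorm nmE io_ge0 V0.
pose q i x := p (T i x).
have qs i : seminorm (q i : realified io X -> R) by exact: seminorm_comp_linear.
have q1 i : nbhs 0 [set x | q i x <= 1].
  have := Tc i 0; rewrite /continuous_at linear0 => /(_ _ p1).
  by apply.
apply: contrapT => noUJ.
pose rad n : R := n.+1%:R^-1.
have rad0 n : 0 < rad n by rewrite invr_gt0.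
(* The power of [4] cancels the factor of the [n]-th hump, so that [(n + 1) / 6] remains at the
   end. *)
pose M n : R := 4 ^+ n * n.+1%:R.
have M1 n : 1 <= M n by rewrite mulr_ege1// ?exprn_ege1// ler1n.
pose G n := [set i | I i /\ forall x, d 0 x < rad n -> q i x <= M n].
(* On a stationary [G n] the maps would be uniformly bounded on a ball; shrinking that ball by
   [2 * M n] would give the equicontinuity that [noUJ] denies. *)
have nsG n : F (~` G n).
  apply: not_stationary => sG; apply: noUJ.
  have M0 : 0 < 2 * M n by have := M1 n; lra.
  exists [set x | d 0 (io (2 * M n) *: x) < rad n], (G n); split=> //.
  - exact: (scale_nbhs0 (io (2 * M n)) (nbhs0_dist (rad0 n))).
  - by move=> i [].
  move=> i [_ hG] _ [x hx <-]; apply: pV.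
  have := hG _ hx; have /= := (qs i).2 (2 * M n) x; rewrite real_scaleE => ->.
  rewrite ger0_norm ?(ltW M0)// mulrAC -[leRHS]mul1r ler_pM2r; last first.
    by have := M1 n; lra.
  by rewrite /q; lra.
have Gdec n : ~` G n.+1 `<=` ~` G n.
  move=> i nG [Ii hG]; apply: nG; split=> // x hx.
  apply: le_trans (hG x _) _.
    apply: lt_le_trans hx _; rewrite lef_pV2 ?posrE// ler_nat.
    by [].
  by rewrite /M ler_pM// ?exprn_ge0// ?ler_nat// ler_eXn2l ?ltr1n.
have [B [sB BI Bal]] := wP _ _ nsG Gdec sI.
have [N BN] := choice (fun k => almost_subset_bound (Bal k)).
(* As [f] dominates the thresholds [N], rapidity makes the [n]-th element [eta n] of [B'] so large
   that it lies outside [G n]. *)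
have [f flt fN] := strictly_increasing_above N.
have [B' [sB' B'B [eta [etalt etar] feta]]] := rap _ _ sB flt.
have etaB' n : B' (eta n) by rewrite -etar; exists n.
have etaB n : B (eta n) := B'B _ (etaB' n).
have exz n : exists2 z, d 0 z < rad n & M n < q (eta n) z.
  have nG : ~ G n (eta n).
    by apply: BN => //; exact: leq_trans (fN n) (feta n).
  apply: contrapT => noz; apply: nG; split; first exact: BI.
  move=> x hx; rewrite leNgt; apply/negP => hq; apply: noz; by exists x.
have [z zr zM] := choice2 exz.
have z0 e : 0 < e -> exists N, forall n, (N <= n)%N -> d 0 (z n) < e.
  move=> e0; have [k ke] := ltr_add_invr e0; rewrite add0r in ke.
  exists k => n kn; apply: lt_trans (zr n) _; apply: le_lt_trans ke.
  by rewrite lef_pV2 ?posrE// ler_nat ltnS.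
(* A maximum exists: the values at [z l] are at most [1] for large [l], while the value at [z n]
   exceeds [M n], which is at least [1]. *)
have exm n : exists m, forall l, q (eta n) (z l) <= q (eta n) (z m).
  have [r r0 rq] := seminorm_small (qs (eta n)) (q1 (eta n)) ltr01.
  have [k hk] := z0 r r0.
  apply: (@eventually_le1_max _ (fun l => q (eta n) (z l)) k n).
    by move=> l kl; exact: rq (hk l kl).
  exact: le_lt_trans (M1 n) (zM n).
have [m mP] := choice exm.
have [s sS|x xP] := @gliding_hump R (realified io X) (fun n => q (eta n))
    (fun n => z (m n)) (fun n => qs (eta n)) (fun n l => mP n (m l)).
  have [x xs] := frechet_complete z0 sS.
  exists x => n e e0.
  have [r r0 rq] := seminorm_small (qs (eta n)) (q1 (eta n)) e0.
  have [k hk] := xs r r0.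
  by exists k => l kl; exact: rq (hk l kl).
have xbig n : n.+1%:R / 6 <= p (T (eta n) x).
  apply: le_trans (xP n); rewrite ler_pM2r ?invr_gt0//.
  have h4 : 0 <= (4^-1 : R) ^+ n by rewrite exprn_ge0 ?invr_ge0.
  have := ler_wpM2l h4 (le_trans (ltW (zM n)) (mP n n)).
  have -> // : 4^-1 ^+ n * M n = n.+1%:R.
  by rewrite /M mulrA -exprMn mulVf ?expr1n ?mul1r// pnatr_eq0.
(* Boundedness at [x] along [F] gives [p (T i x) <= (nm t)^-1] on a set of [F], which meets [B'] in
   some [eta n] with [n] as large as desired. *)
have [t t0 Ft] := Tb x _ p1.
have nt0 : 0 < nm t by rewrite -(ltr_io io_ge0) rmorph0 -(nm_pos nmE t0).
have [k hk] : exists k : nat, 6 / nm t < k%:R.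
  exists (Num.bound (6 / nm t)); apply: archi_boundP.
  by rewrite divr_ge0// ltW.
have sBt := stationaryI FF sB' Ft.
have [i [B'i ti] ki] := stationary_ge Ffree (eta k) sBt.
have [n _ etan] : range eta i by rewrite etar.
have kn : (k <= n)%N.
  rewrite leqNgt; apply/negP => /etalt; rewrite etan ltnNge ki.
  by [].
move: ti; rewrite /= (nm_pos nmE t0).
have /= := ps.2 (nm t) (T i x); rewrite real_scaleE => ->.
rewrite ger0_norm ?(ltW nt0)// -ler_pdivlMl// mulr1 => pt.
have := xbig n; rewrite etan => h.
have : (k%:R : R) < n.+1%:R by rewrite ltr_nat ltnS.
move: hk h pt; set a := p _; set b := (nm t)^-1; lra.
Qed.

End Frechet.
End Sufficiency.

(** * The Banach space of bounded sequences *)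

Section BoundedSequences.
Context {K : numFieldType}.

Definition bounded_seq (f : nat -> K) : Prop := exists C, forall n, `|f n| <= C.

Definition linfty : Type := {f : nat -> K | bounded_seq f}.

Definition linfty_at (x : linfty) (n : nat) : K := sval x n.

Lemma linfty_ext (x y : linfty) : (forall n, linfty_at x n = linfty_at y n) -> x = y.
Proof.
move: x y => [f fb] [g gb] /= fg; have {}fg : f = g by apply/funext.
by subst g; congr exist; exact: Prop_irrelevance.
Qed.

HB.instance Definition _ := gen_eqMixin linfty.
HB.instance Definition _ := gen_choiceMixin linfty.

Lemma bounded_seq0 : bounded_seq (fun=> 0).
Proof. by exists 0 => n; rewrite normr0. Qed.

Lemma bounded_seqD f g : bounded_seq f -> bounded_seq g ->
  bounded_seq (fun n => f n + g n).
Proof.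
move=> [C fC] [D gD]; exists (C + D) => n.
by rewrite (le_trans (ler_normD _ _))// lerD.
Qed.

Lemma bounded_seqZ a f : bounded_seq f -> bounded_seq (fun n => a * f n).
Proof. by move=> [C fC]; exists (`|a| * C) => n; rewrite normrM ler_wpM2l. Qed.

Lemma bounded_seqN f : bounded_seq f -> bounded_seq (fun n => - f n).
Proof. by move=> [C fC]; exists C => n; rewrite normrN. Qed.

Definition linfty0 : linfty := exist _ _ bounded_seq0.
Definition linfty_add (x y : linfty) : linfty :=
  exist _ _ (bounded_seqD (svalP x) (svalP y)).
Definition linfty_opp (x : linfty) : linfty := exist _ _ (bounded_seqN (svalP x)).
Definition linfty_scale (a : K) (x : linfty) : linfty :=
  exist _ _ (bounded_seqZ a (svalP x)).

Lemma linfty_addA : associative linfty_add.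
Proof. by move=> x y z; apply: linfty_ext => n; rewrite /linfty_at/= addrA. Qed.
Lemma linfty_addC : commutative linfty_add.
Proof. by move=> x y; apply: linfty_ext => n; rewrite /linfty_at/= addrC. Qed.
Lemma linfty_add0 : left_id linfty0 linfty_add.
Proof. by move=> x; apply: linfty_ext => n; rewrite /linfty_at/= add0r. Qed.
Lemma linfty_addN : left_inverse linfty0 linfty_opp linfty_add.
Proof. by move=> x; apply: linfty_ext => n; rewrite /linfty_at/= addNr. Qed.

HB.instance Definition _ := GRing.isZmodule.Build linfty
  linfty_addA linfty_addC linfty_add0 linfty_addN.

Lemma linfty_scaleA a b x : linfty_scale a (linfty_scale b x) = linfty_scale (a * b) x.
Proof. by apply: linfty_ext => n; rewrite /linfty_at/= mulrA. Qed.
Lemma linfty_scale1 : left_id 1 linfty_scale.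
Proof. by move=> x; apply: linfty_ext => n; rewrite /linfty_at/= mul1r. Qed.
Lemma linfty_scaleDr : right_distributive linfty_scale +%R.
Proof. by move=> a x y; apply: linfty_ext => n; rewrite /linfty_at/= mulrDr. Qed.
Lemma linfty_scaleDl x : {morph linfty_scale^~ x : a b / a + b}.
Proof. by move=> a b; apply: linfty_ext => n; rewrite /linfty_at/= mulrDl. Qed.

HB.instance Definition _ := GRing.Zmodule_isLmodule.Build K linfty
  linfty_scaleA linfty_scale1 linfty_scaleDr linfty_scaleDl.

(** An isomorphism with row vectors of length [n], restricted to sequences supported on the first
    [n + 1] places, would be an injective linear map that lowers the dimension. *)
Lemma linfty_infinite_dimensional : infinite_dimensional linfty.
Proof.
move=> n [v2r v2rl v2rb].
have ext_bounded (w : 'rV[K]_n.+1) :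
    bounded_seq (fun k => if (k < n.+1)%N then w 0 (inord k) else 0).
  exists (\sum_i `|w 0 i|) => k; case: ifP => _.
    by rewrite (bigD1 (inord k))//= lerDl sumr_ge0.
  by rewrite normr0 sumr_ge0.
pose g (w : 'rV[K]_n.+1) : linfty := exist _ _ (ext_bounded w).
have gl : linear (v2r \o g).
  move=> a u w; rewrite /= -v2rl; congr v2r; apply: linfty_ext => k.
  by rewrite /linfty_at /=; case: ifP => _; rewrite ?mxE// mulr0 addr0.
pose glb := GRing.isLinear.Build _ _ _ _ (v2r \o g) gl.
pose G : {linear 'rV[K]_n.+1 -> 'rV[K]_n} := HB.pack (v2r \o g) glb.
have : ~~ row_free (lin1_mx G).
  by rewrite /row_free ltn_eqF// ltnS rank_leq_col.
rewrite -kermx_eq0 => /rowV0Pn [w /sub_kermxP wG w0].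
have Gw : v2r (g w) = v2r (g 0).
  have Gw0 : G w = 0 by rewrite -mul_rV_lin1 wG.
  exact: etrans (Gw0 : v2r (g w) = 0) (esym (linear0 G : v2r (g 0) = 0)).
have gw := bij_inj v2rb Gw.
case/eqP: w0; apply/matrixP => i j; rewrite ord1.
have := congr1 (linfty_at^~ (j : nat)) gw.
by rewrite /linfty_at /= ltn_ord inord_val !mxE.
Qed.

End BoundedSequences.
Arguments linfty : clear implicits.

Section BanachSpaces.
Context {R : realType} {K : numFieldType} (io : {rmorphism R -> K}) (nm : K -> R).
Hypothesis nmE : forall z, `|z| = io (nm z).
Hypothesis io_ge0 : forall a, 0 <= a -> 0 <= io a.

Lemma complete_normed_seq_cvg (X : completeNormedModType K) (u : nat -> X) :
  (forall e, 0 < e -> exists N, forall m n,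
    (N <= m)%N -> (N <= n)%N -> nm `|u m - u n| < e) ->
  exists l : X, u @ \oo --> l.
Proof.
move=> uc; suff : cvg (u @ \oo) by move=> h; exists (lim (u @ \oo)).
apply: cauchy_cvg; apply/cauchyP => e e0.
have ne0 : 0 < nm e by rewrite -(ltr_io io_ge0) rmorph0 -(nm_pos nmE e0).
have [N hN] := uc _ ne0; exists (u N), N => // n /= Nn.
rewrite -ball_normE /= (nm_pos nmE e0) -[`|_|]normr_id nmE (ltr_io io_ge0).
exact: hN.
Qed.

Lemma banach_frechet (X : completeNormedModType K) : frechet_space R (X : tvsType K).
Proof.
exists (fun x y => nm `|x - y|).
have nE (x : X) : `|x| = io (nm `|x|) by rewrite -nmE normr_id.
split; last exact: complete_normed_seq_cvg.
- split=> [x y|x y|x y z].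
  + split=> [xy|->]; last first.
      by rewrite subrr normr0 -[X in nm X](rmorph0 io) (nm_io nmE io_ge0) normr0.
    by apply/eqP; rewrite -subr_eq0 -normr_eq0 nE xy rmorph0.
  + by rewrite distrC.
  + by rewrite -(ler_io io_ge0) rmorphD -!nE ler_distD.
- by move=> x y z; rewrite opprD addrACA subrr addr0.
- move=> x; apply/seteqP; split=> W.
    move=> /nbhs_ballP [e /= e0 eW].
    exists (nm e) => /=; first by rewrite -(ltr_io io_ge0) rmorph0 -(nm_pos nmE e0).
    move=> y /= xy; apply: eW; rewrite -ball_normE /= nE (nm_pos nmE e0).
    by rewrite (ltr_io io_ge0).
  move=> [e /= e0 eW]; apply/nbhs_ballP; exists (io e) => /=.
    by rewrite -(rmorph0 io) (ltr_io io_ge0).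
  move=> y; rewrite -ball_normE /= nE (ltr_io io_ge0) => xy; exact: eW.
Qed.

Hypothesis K_complete : forall u : nat -> K,
  (forall e, 0 < e -> exists N, forall m n,
    (N <= m)%N -> (N <= n)%N -> nm (u m - u n) < e) ->
  exists l, forall e, 0 < e -> exists N, forall n, (N <= n)%N -> nm (l - u n) <= e.

(** The supremum is formed in [R], which has suprema, and then carried to [K], where the norm takes
    its values. *)
Definition linfty_norm (x : linfty K) : K := io (sup [set nm (linfty_at x n) | n in setT]).

Lemma linfty_has_sup x : has_sup [set nm (linfty_at x n) | n in setT].
Proof.
split; first by exists (nm (linfty_at x 0)), 0%N.
have [C xC] := svalP x; exists (nm C) => _ [n _ <-].
have C0 : 0 <= C by exact: le_trans (xC 0%N).
by rewrite (nm_le nmE io_ge0) (le_trans (xC n))// ger0_norm.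
Qed.

Lemma linfty_norm_ge x n : `|linfty_at x n| <= linfty_norm x.
Proof.
rewrite nmE (ler_io io_ge0); apply: ub_le_sup; last by exists n.
by have [] := linfty_has_sup x.
Qed.

Lemma linfty_norm_le x C : (forall n, nm (linfty_at x n) <= C) -> linfty_norm x <= io C.
Proof.
move=> xC; rewrite (ler_io io_ge0); apply: ge_sup; first by have [] := linfty_has_sup x.
by move=> _ [n _ <-].
Qed.

Lemma linfty_norm_leK x (C : K) : (forall n, `|linfty_at x n| <= C) -> linfty_norm x <= C.
Proof.
move=> xC; have C0 : 0 <= C by exact: le_trans (xC 0%N).
have -> : C = io (nm C) by rewrite -nmE ger0_norm.
apply: linfty_norm_le => n; rewrite (nm_le nmE io_ge0).
by rewrite (le_trans (xC n))// ger0_norm.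
Qed.

Lemma linfty_normD x y : linfty_norm (x + y) <= linfty_norm x + linfty_norm y.
Proof.
apply: linfty_norm_leK => n; rewrite /linfty_at /=.
by rewrite (le_trans (ler_normD _ _))// lerD//; exact: linfty_norm_ge.
Qed.

Lemma linfty_norm_eq0 x : linfty_norm x = 0 -> x = 0.
Proof.
move=> x0; apply: linfty_ext => n; apply/eqP; rewrite -normr_le0 -x0.
exact: linfty_norm_ge.
Qed.

Lemma linfty_normZ a x : linfty_norm (a *: x) = `|a| * linfty_norm x.
Proof.
have le b y : linfty_norm (b *: y) <= `|b| * linfty_norm y.
  apply: linfty_norm_leK => n; rewrite /linfty_at /= normrM ler_wpM2l//.
  exact: linfty_norm_ge.
apply/eqP; rewrite eq_le le/=.
have [->|a0] := eqVneq a 0.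
  by rewrite normr0 mul0r (le_trans _ (linfty_norm_ge _ 0%N)).
have := le a^-1 (a *: x); rewrite scalerA mulVf// scale1r normfV.
by rewrite ler_pdivlMl ?normr_gt0.
Qed.

Definition linfty_normed_mixin := Lmodule_isNormed.Build K (linfty K)
  linfty_normD linfty_normZ linfty_norm_eq0.

Definition linfty_normed : normedModType K := HB.pack (linfty K) linfty_normed_mixin.

(** Centres [x k] of balls of radius [1 / (k + 1)] that belong to [G] replace the filter by a
    sequence. It converges coordinatewise at a rate that is uniform in the coordinate, hence in
    norm. *)
Lemma linfty_complete (G : set_system linfty_normed) :
  ProperFilter G -> cauchy G -> cvg G.
Proof.
move=> GG /cauchyP Gc.
have inv0 k : 0 < k.+1%:R^-1 :> R by rewrite invr_gt0.
have exx k : exists x : linfty_normed, G (ball x (io k.+1%:R^-1)).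
  by apply: Gc; rewrite -(rmorph0 io) (ltr_io io_ge0).
have [x xG] := choice exx.
have at_le (y z : linfty_normed) n : `|linfty_at y n - linfty_at z n| <= `|y - z|.
  exact: (linfty_norm_ge (y - z) n).
have close k l n : nm (linfty_at (x k) n - linfty_at (x l) n) <=
    k.+1%:R^-1 + l.+1%:R^-1.
  have [y [yk yl]] := filter_ex (filterI (xG k) (xG l)).
  rewrite -(ler_io io_ge0) -nmE rmorphD.
  rewrite (le_trans (at_le _ _ _))// (le_trans (ler_distD y _ _))// lerD//.
    by move: yk; rewrite -ball_normE /= => /ltW.
  by move: yl; rewrite -ball_normE /= distrC => /ltW.
have small e : 0 < e -> exists k, forall l, (k <= l)%N -> l.+1%:R^-1 < e :> R.
  move=> e0; have [k ke] := ltr_add_invr e0; rewrite add0r in ke.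
  by exists k => l kl; apply: le_lt_trans ke; rewrite lef_pV2 ?posrE// ler_nat.
have exl n : exists l, forall e, 0 < e -> exists N, forall k, (N <= k)%N ->
    nm (l - linfty_at (x k) n) <= e.
  apply: K_complete => e e0; have [k hk] := small (e / 2) (divr_gt0 e0 (ltr0Sn _ 1)).
  exists k => i j ki kj; apply: le_lt_trans (close i j n) _.
  by rewrite [ltRHS]splitr; apply: ltrD; exact: hk.
have [l lP] := choice exl.
have lx k n : nm (l n - linfty_at (x k) n) <= k.+1%:R^-1.
  apply/ler_addgt0Pr => e e0; have e20 : 0 < e / 2 by rewrite divr_gt0.
  have [N hN] := lP n _ e20; have [N' hN'] := small _ e20.
  pose i := maxn N N'.
  have h1 := hN i (leq_maxl _ _); have h2 := ltW (hN' i (leq_maxr _ _)).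
  have h3 := close i k n.
  have : nm (l n - linfty_at (x k) n) <= nm (l n - linfty_at (x i) n) +
      nm (linfty_at (x i) n - linfty_at (x k) n).
    by rewrite -(ler_io io_ge0) rmorphD -!nmE ler_distD.
  move: h1 h2 h3; set a := i.+1%:R^-1; set b := k.+1%:R^-1; lra.
have lb : bounded_seq l.
  have [C xC] := svalP (x 0%N); exists (C + io 1) => n.
  rewrite -[l n](subrK (linfty_at (x 0%N) n)) addrC.
  rewrite (le_trans (ler_normD _ _))// lerD ?xC//.
  by rewrite nmE (ler_io io_ge0) (le_trans (lx 0%N n))// invr1.
pose L : linfty_normed := exist _ l lb.
apply/cvg_ex; exists L; apply/cvgrPdist_lt => e e0.
have ne0 : 0 < nm e by rewrite -(ltr_io io_ge0) rmorph0 -(nm_pos nmE e0).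
have [k hk] := small _ (divr_gt0 ne0 (ltr0Sn _ 1)).
apply: filterS (xG k) => y; rewrite -ball_normE /= => xy.
rewrite (le_lt_trans (ler_distD (x k) _ _))//.
have Lx : `|L - x k| <= io k.+1%:R^-1.
  by apply: (@linfty_norm_le (L - x k)) => n; exact: lx.
apply: le_lt_trans (lerD Lx (ltW xy)) _.
rewrite -rmorphD [ltRHS](nm_pos nmE e0) (ltr_io io_ge0) [ltRHS]splitr.
by apply: ltrD; exact: hk.
Qed.

Lemma exists_infinite_dimensional_banach :
  exists X : completeNormedModType K, infinite_dimensional X.
Proof.
pose c := Uniform_isComplete.Build linfty_normed linfty_complete.
pose X : completeNormedModType K := HB.pack (linfty K) linfty_normed c.
by exists X; exact: linfty_infinite_dimensional.
Qed.

End BanachSpaces.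

(** * The equivalence *)

Section CompletenessOfScalars.
Context {R : realType}.

Lemma real_seq_complete (u : nat -> R) :
  (forall e, 0 < e -> exists N, forall m n,
    (N <= m)%N -> (N <= n)%N -> `|u m - u n| < e) ->
  exists l, forall e, 0 < e -> exists N, forall n, (N <= n)%N -> `|l - u n| <= e.
Proof.
move=> uc; have [l ul] : exists l : R^o, u @ \oo --> l.
  apply: (@complete_normed_seq_cvg R R (idfun : {rmorphism R -> R})
    (fun z => `|z|)) => // e e0.
  have [N hN] := uc e e0; exists N => m n Nm Nn.
  by rewrite normr_id; exact: hN.
exists l => e e0; have /cvgrPdist_le /(_ e e0) [N _ hN] := ul.
by exists N => n Nn; exact: hN.
Qed.

Lemma complex_seq_complete (u : nat -> R[i]) :
  (forall e : R, 0 < e -> exists N, forall m n,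
    (N <= m)%N -> (N <= n)%N -> complex_modulus (u m - u n) < e) ->
  exists l, forall e : R, 0 < e -> exists N, forall n, (N <= n)%N ->
    complex_modulus (l - u n) <= e.
Proof.
move=> uc.
have ReB (z w : R[i]) : complex.Re (z - w) = complex.Re z - complex.Re w.
  by case: z w => [? ?] [? ?].
have ImB (z w : R[i]) : complex.Im (z - w) = complex.Im z - complex.Im w.
  by case: z w => [? ?] [? ?].
have [e e0|a ha] := @real_seq_complete (fun n => complex.Re (u n)).
  have [N hN] := uc e e0; exists N => m n Nm Nn; rewrite -ReB.
  exact: le_lt_trans (complex_modulus_ge _) (hN m n Nm Nn).
have [e e0|b hb] := @real_seq_complete (fun n => complex.Im (u n)).
  have [N hN] := uc e e0; exists N => m n Nm Nn; rewrite -ImB.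
  exact: le_lt_trans (complex_modulus_ge_Im _) (hN m n Nm Nn).
exists (a +i* b)%C => e e0; have e20 : 0 < e / 2 by rewrite divr_gt0.
have [N hN] := ha _ e20; have [M hM] := hb _ e20.
exists (maxn N M) => n; rewrite geq_max => /andP[Nn Mn].
apply: le_trans (complex_modulus_le _) _; rewrite ReB ImB /= [leRHS]splitr.
by rewrite lerD// ?hN ?hM.
Qed.

End CompletenessOfScalars.

(** The real and the complex case at once. Banach spaces are Frechet and the bounded sequences form
    an infinite-dimensional one, so the second statement implies the first; the first implies the
    third by necessity and the third the second by sufficiency. *)
Lemma stationary_ub_equiv (R : realType) (K : numFieldType)
    (io : {rmorphism R -> K}) (nm : K -> R)
    (nmE : forall z, `|z| = io (nm z)) (io_ge0 : forall a, 0 <= a -> 0 <= io a)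
    (cplx : complexifiable io nm)
    (K_complete : forall u : nat -> K,
      (forall e, 0 < e -> exists N, forall m n,
        (N <= m)%N -> (N <= n)%N -> nm (u m - u n) < e) ->
      exists l, forall e, 0 < e -> exists N, forall n, (N <= n)%N -> nm (l - u n) <= e)
    (F : set_system nat) (FF : ProperFilter F) (Ffree : free_filter F) :
  [<-> exists X : completeNormedModType K,
         infinite_dimensional X /\ stationary_uniform_boundedness F X;
       forall X : tvsType K,
         frechet_space R X -> stationary_uniform_boundedness F X;
       rapid_plus_filter F /\ weak_Pplus_filter F].
Proof.
have sufficient : rapid_plus_filter F /\ weak_Pplus_filter F ->
    forall X : tvsType K, frechet_space R X -> stationary_uniform_boundedness F X.
  move=> [rap wP] X [d [[_ dsym _] dtrans dnbhs dcomplete]].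
  exact: (stationary_ub_frechet nmE io_ge0 dtrans dsym dnbhs dcomplete).
have nec : (exists X : completeNormedModType K,
    infinite_dimensional X /\ stationary_uniform_boundedness F X) ->
    rapid_plus_filter F /\ weak_Pplus_filter F.
  by move=> [X [Xinf Xub]]; exact: (stationary_ub_infinite_dimensional nmE io_ge0 cplx FF Ffree Xinf Xub).
have banach : (forall X : tvsType K,
      frechet_space R X -> stationary_uniform_boundedness F X) ->
    exists X : completeNormedModType K,
      infinite_dimensional X /\ stationary_uniform_boundedness F X.
  move=> h; have [X Xinf] := exists_infinite_dimensional_banach nmE io_ge0 K_complete.
  by exists X; split=> //; apply: h; exact: (banach_frechet nmE io_ge0).
by tfae=> [/nec /sufficient//|/banach /nec//|/sufficient /banach].
Qed.

Theorem theorem5p2 (R : realType) (K : numFieldType)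
    (hK : K = (R : numFieldType) \/ K = (R[i] : numFieldType))
    (F : set_system nat) (FF : ProperFilter F) (Ffree : free_filter F) :
  [<-> exists X : completeNormedModType K,
         infinite_dimensional X /\ stationary_uniform_boundedness F X;
       forall X : tvsType K,
         frechet_space R X -> stationary_uniform_boundedness F X;
       rapid_plus_filter F /\ weak_Pplus_filter F].
Proof.
case: hK => KE; subst K.
- apply: (@stationary_ub_equiv R R (idfun : {rmorphism R -> R}) (fun z => `|z|)) => //.
  + exact: complexifiable_real.
  + exact: real_seq_complete.
- apply: (@stationary_ub_equiv R R[i] (real_complex R : {rmorphism R -> R[i]})
    complex_modulus) => //.
  + by move=> z; rewrite normc_def.
  + by move=> a a0; rewrite lecE /= eqxx.
  + exact: complexifiable_complex.
  + exact: complex_seq_complete.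
Qed.
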